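(* Let $Z,W,A_\star,B_\star,\hat Z,H$ be as in the context. For a given symmetric polynomial matrix $\Xi:\mathbb R^n\to\mathbb R^{\hat N\times\hat N}$ and a given scalar $\varepsilon>0$, suppose there exist a matrix $P=P^\top\succ0$ in $\mathbb R^{\hat N\times\hat N}$, polynomial matrices $Y:\mathbb R^n\to\mathbb R^{m\times\hat N}$ and $\Gamma:\mathbb R\to\mathbb R^{m\times m}$, a symmetric polynomial matrix $\Theta:\mathbb R^n\to\mathbb R^{\hat N\times\hat N}$, a scalar $\eta>0$, and SOS polynomial matrices $S_\Theta$ (in $x$) and $S_\partial$ (in $(x,w)$) such that for all $r\in\mathbb R$, $x\in\mathbb R^n$ and $w\in\mathbb R^m$: (a) $\Gamma(r)=\sum_{j=0}^{\nu}C_jr^{2j}$ for some integer $\nu\ge0$ and matrices $C_0=C_0^\top\succeq0,\dots,C_\nu=C_\nu^\top\succeq0$ with $\sum_{j=0}^{\nu}C_j\succeq\varepsilon I$; (b) $\Theta(x)-\eta\,\Xi(x)=S_\Theta(x)$; (c) $$\begin{bmatrix}\mathrm{Tp}\Big(\frac{\partial\hat Z(x)}{\partial x}[A_\star\ \,B_\star]\begin{bmatrix}H(x)P\\ W(x)Y(x)\end{bmatrix}\Big)+\Theta(x)&\star\\ \begin{bmatrix}0\\ W(x)\end{bmatrix}^\top[A_\star\ \,B_\star]^\top\frac{\partial\hat Z(x)}{\partial x}^\top&-\Gamma(|w|)\end{bmatrix}=-S_\partial(x,w).$$ Then, if the function $b(x):=\hat Z(x)^\top P^{-1}\Xi(x)P^{-1}\hat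 Z(x)$ is positive definite and radially unbounded, the closed-loop system $$\dot x=[A_\star\ \,B_\star]\begin{bmatrix}H(x)\hat Z(x)\\ W(x)\big(Y(x)P^{-1}\hat Z(x)+w\big)\end{bmatrix}$$ is input-to-state stable (ISS) with respect to the actuator disturbance $w\in\mathbb R^m$.
   Context: System and libraries. $x\in\mathbb R^n$ is the state and $u\in\mathbb R^m$ the input. $Z:\mathbb R^n\to\mathbb R^N$ and $W:\mathbb R^n\to\mathbb R^{M\times m}$ are known function libraries whose elements are monomials of $x$, with $Z(0)=0$. The system is $\dot x=A_\star Z(x)+B_\star W(x)u$ for constant matrices $A_\star\in\mathbb R^{n\times N}$, $B_\star\in\mathbb R^{n\times M}$. Reduced library. $\hat Z:\mathbb R^n\to\mathbb R^{\hat N}$ is a polynomial vector and $H:\mathbb R^n\to\mathbb R^{N\times\hat N}$ a polynomial matrix such that $\hat Z(x)=0$ if and only if $x=0$, $Z(x)=H(x)\hat Z(x)$ for all $x$, and $|\hat Z(x)|\to\infty$ as $|x|\to\infty$. Notation. $|\cdot|$ is the Euclidean norm; $\succ,\succeq$ refer to the semidefinite order on symmetric matrices; $\mathrm{Tp}(A):=A+A^\top$; $\star$ denotes the blocks making a matrix symmetric; $\frac{\partial\hat Z}{\partial x}$ is the ($\hat N\times n$) Jacobian matrix. A function $f:\mathbb R^n\to\mathbb R$ is positive definite if $f(0)=0$ and $f(x)>0$ for $x\ne0$, and radially unbounded if $f(x)\to\infty$ as $|x|\to\infty$. A symmetric polynomial matrix $S$ is SOS if $S=R^\top R$ for some polynomial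 matrix $R$. ISS. A continuous $\gamma:[0,\infty)\to[0,\infty)$ is of class $\mathcal K$ if it is strictly increasing and $\gamma(0)=0$. A continuous $\beta:[0,\infty)\times[0,\infty)\to[0,\infty)$ is of class $\mathcal{KL}$ if $\beta(\cdot,s)$ is of class $\mathcal K$ for each fixed $s$ and, for each fixed $r$, $\beta(r,\cdot)$ is decreasing with $\lim_{s\to\infty}\beta(r,s)=0$. A system $\dot x=F(x,v)$, $F(0,0)=0$, $F$ locally Lipschitz, with input $v\in\mathbb R^p$, is ISS with respect to $v$ if there exist $\beta$ of class $\mathcal{KL}$ and $\gamma$ of class $\mathcal K$ such that for each $x^\circ\in\mathbb R^n$ and each piecewise continuous bounded $v:[0,\infty)\to\mathbb R^p$, the solution with $x(0)=x^\circ$ satisfies $|x(t)|\le\beta(|x^\circ|,t)+\gamma(\sup_{s\ge0}|v(s)|)$ for all $t\ge0$. *)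

(* Defs.v *)
From mathcomp Require Import all_boot all_order all_algebra.
From mathcomp Require Import all_classical all_reals all_analysis.
(* The notations of mpoly clash with those of MathComp-Analysis. *)
From mathcomp Require mpoly.
Import (canonicals, coercions) mpoly.

Set Implicit Arguments.
Unset Strict Implicit.
Unset Printing Implicit Defensive.

Import Order.TTheory GRing.Theory Num.Theory.
Import numFieldNormedType.Exports.

Local Open Scope classical_set_scope.
Local Open Scope ring_scope.

(* The norm that MathComp-Analysis puts on matrices is the maximum norm. *)
Definition enorm (R : realType) (n : nat) (x : 'cV[R]_n) : R :=
  Num.sqrt (\sum_(i < n) x i 0 ^+ 2).

Definition posdefmx (R : realType) (n : nat) (A : 'M[R]_n) : Prop :=
  A^T = A /\ forall x : 'cV[R]_n, x != 0 -> 0 < (x^T *m A *m x) 0 0.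

Definition psdmx (R : realType) (n : nat) (A : 'M[R]_n) : Prop :=
  A^T = A /\ forall x : 'cV[R]_n, 0 <= (x^T *m A *m x) 0 0.

Definition Tp (R : realType) (n : nat) (A : 'M[R]_n) : 'M[R]_n := A + A^T.

(* A coefficient is allowed, possibly zero, so that null entries of a library
   are covered. *)
Definition monomial_fun (R : realType) (n : nat) (f : 'cV[R]_n -> R) : Prop :=
  exists (c : R) (e : 'I_n -> nat),
    forall x, f x = c * \prod_(i < n) x i 0 ^+ e i.

Definition polynomial_fun (R : realType) (n : nat) (f : 'cV[R]_n -> R) : Prop :=
  exists p : mpoly.mpoly n R,
    forall x, f x = mpoly.meval (fun i => x i 0) p.

Definition polymx (R : realType) (n p q : nat) (F : 'cV[R]_n -> 'M[R]_(p, q)) :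
  Prop := forall i j, polynomial_fun (fun x => F x i j).

Definition sym_polymx (R : realType) (n p : nat) (S : 'cV[R]_n -> 'M[R]_p) :
  Prop := polymx S /\ forall x, (S x)^T = S x.

Definition univ_polymx (R : realType) (p q : nat) (G : R -> 'M[R]_(p, q)) :
  Prop := exists g : 'M[{poly R}]_(p, q), forall r i j, G r i j = (g i j).[r].

Definition sos_polymx (R : realType) (n p : nat) (S : 'cV[R]_n -> 'M[R]_p) :
  Prop :=
  sym_polymx S /\
  exists (k : nat) (Q : 'cV[R]_n -> 'M[R]_(k, p)),
    polymx Q /\ forall x, S x = (Q x)^T *m Q x.

(* The library's jacobian is for maps between row vectors, and is the
   transpose of this one. *)
Definition jacobian_mx (R : realType) (n p : nat) (f : 'cV[R]_n -> 'cV[R]_p)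
    (x : 'cV[R]_n) : 'M[R]_(p, n) :=
  \matrix_(i < p, j < n) 'D_(delta_mx j 0) (fun y => f y i 0) x.

Definition posdef_fun (R : realType) (n : nat) (f : 'cV[R]_n -> R) : Prop :=
  f 0 = 0 /\ forall x, x != 0 -> 0 < f x.

Definition radially_unbounded (R : realType) (n : nat) (f : 'cV[R]_n -> R) :
  Prop := forall M : R, exists r : R, forall x, r <= enorm x -> M <= f x.

(* Functions on [0, +oo) are represented by functions on R, whose values at
   negative arguments are irrelevant. *)
Definition class_K (R : realType) (g : R -> R) : Prop :=
  [/\ {within `[0, +oo[, continuous g},
      forall r : R, 0 <= r -> 0 <= g r,
      forall r s : R, 0 <= r -> r < s -> g r < g s
    & g 0 = 0].

(* Decrease in the second argument is not strict: beta 0 _ vanishes. *)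
Definition class_KL (R : realType) (beta : R -> R -> R) : Prop :=
  [/\ {within [set z : R * R | 0 <= z.1 /\ 0 <= z.2],
         continuous (fun z => beta z.1 z.2)},
      forall s : R, 0 <= s -> class_K (beta^~ s),
      forall r s t : R, 0 <= r -> 0 <= s -> s <= t -> beta r t <= beta r s
    & forall r : R, 0 <= r -> beta r s @[s --> +oo] --> (0 : R)].

Definition piecewise_continuous (R : realType) (p : nat) (v : R -> 'cV[R]_p) :
  Prop :=
  [/\ forall T : R,
        finite_set [set t : R | [/\ 0 < t, t < T & ~ {for t, continuous v}]],
      forall t : R, 0 <= t -> cvg (v @ t^'+)
    & forall t : R, 0 < t -> cvg (v @ t^'-)].

(* The differential equation cannot be required at the points where a
   piecewise continuous input jumps. *)
Definition is_solution (R : realType) (n p : nat)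
    (F : 'cV[R]_n -> 'cV[R]_p -> 'cV[R]_n) (v : R -> 'cV[R]_p)
    (x0 : 'cV[R]_n) (x : R -> 'cV[R]_n) : Prop :=
  [/\ x 0 = x0,
      {within `[0, +oo[, continuous x}
    & forall t : R, 0 < t -> {for t, continuous v} ->
        is_derive t 1 x (F (x t) (v t))].

Definition sup_enorm (R : realType) (p : nat) (v : R -> 'cV[R]_p) : R :=
  sup [set enorm (v s) | s in [set s : R | 0 <= s]].

(* "The solution satisfies the bound for all t >= 0" includes that it exists
   on the whole of [0, +oo). *)
Definition ISS (R : realType) (n p : nat)
    (F : 'cV[R]_n -> 'cV[R]_p -> 'cV[R]_n) : Prop :=
  [/\ F 0 0 = 0,
      [locally [lipschitz F z.1 z.2 | z in [set: 'cV[R]_n * 'cV[R]_p]]]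
    & exists (beta : R -> R -> R) (gamma : R -> R),
        [/\ class_KL beta, class_K gamma
          & forall (x0 : 'cV[R]_n) (v : R -> 'cV[R]_p),
              piecewise_continuous v ->
              [bounded v s | s in [set s : R | 0 <= s]] ->
              (exists x, is_solution F v x0 x) /\
              forall x, is_solution F v x0 x ->
              forall t : R, 0 <= t ->
                enorm (x t) <= beta (enorm x0) t + gamma (sup_enorm v)]].

(* Main.v *)
(* Along the closed loop, V = Zh^T P^-1 Zh satisfies V' <= - eta b(x) + w^T
   Gamma(|w|) w: evaluate the quadratic form of the matrix inequality at (P^-1
   Zh(x), w) and use the two sum-of-squares conditions. Since V, b and |x| are
   positive definite and proper, they are comparable through class K_oo
   functions, which turns this into V' <= - 2 alpha(V) + sigma(|w|). As long
   as V >= rho := alpha^-1(sigma(sup |w|)) this gives V' <= - alpha(V), and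
   since V is then nonincreasing, V(t) + t alpha(V(t)) <= V(0). Hence V(t) <=
   max(phi(V(0), t), rho), where s = phi(r, t) solves s + t alpha(s) = r; phi
   is of class KL, so no comparison differential equation has to be solved.
   Solutions exist globally because the same estimate holds for the vector
   field multiplied by a cutoff, which is globally Lipschitz and to which
   Picard iteration applies. *)
Require Import Defs.
From mathcomp Require Import all_boot all_order all_algebra.
From mathcomp Require Import all_classical all_reals all_analysis.
From mathcomp Require mpoly.
From mathcomp Require Import measurable_realfun ring lra.
Import (coercions) mpoly.

Set Implicit Arguments.
Unset Strict Implicit.
Unset Printing Implicit Defensive.

Import Order.TTheory GRing.Theory Num.Theory.
Import numFieldNormedType.Exports.

Local Open Scope classical_set_scope.
Local Open Scope ring_scope.

(** * Lipschitz functions on bounded sets *)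

Section LipschitzOnBoundedSets.
Context {R : realType}.
Implicit Types U V : normedModType R.

(** The input may jump, so a trajectory is differentiable only off a set of times that is finite on
    bounded intervals. Every differential argument is therefore reduced to one fact: a continuous
    function whose derivative is nonpositive off such a set is nonincreasing.

    The cutoff rescales the vector field by a factor in [0, 1], which keeps V' nonpositive wherever
    it was. A sublevel set of V, taken at a level where dissipation beats the supremum of the input,
    thus remains invariant; the cutoff equals one there, so the truncated trajectory solves the
    original equation.

    The norm |w| is not polynomial, but it enters Gamma through even powers only, so Lipschitz
    bounds on balls supply all the regularity. In -2 alpha(V), one alpha(V) absorbs sigma and the
    other drives the decay. *)

Lemma lipschitz_continuous_at U V (f : U -> V) (x : U) (L : R) : 0 <= L ->
  (forall y, `|y| <= `|x| + 1 -> `|f x - f y| <= L * `|x - y|) ->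
  {for x, continuous f}.
Proof.
move=> L0 HL; apply/cvgrPdist_le => e e0; near=> y.
have xy : `|x - y| <= e / (L + 1).
  by near: y; apply: cvgr_dist_le => //; rewrite divr_gt0// ltr_wpDl.
have xy1 : `|x - y| <= 1 by near: y; exact: cvgr_dist_le.
rewrite (le_trans (HL y _))//.
  by rewrite -[y](subKr x) (le_trans (ler_normB _ _))// lerD2l.
rewrite (le_trans (ler_wpM2l L0 xy))// mulrCA ler_piMr ?ltW//.
by rewrite ltr_pdivrMr ?ltr_wpDl// mul1r ltrDl.
Unshelve. all: by end_near. Qed.

Lemma lipschitz_continuous U V (f : U -> V) (L : R) :
  (forall x y, `|f x - f y| <= L * `|x - y|) -> continuous f.
Proof.
move=> H x; apply: (@lipschitz_continuous_at _ _ _ _ `|L|) => // y _.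
by rewrite (le_trans (H x y))// ler_wpM2r// ler_norm.
Qed.

Lemma lipschitz_bounded U V (f : U -> V) (K L : R) : 0 <= L ->
  (forall x y, `|x| <= K -> `|y| <= K -> `|f x - f y| <= L * `|x - y|) ->
  exists2 B : R, 0 < B & forall x, `|x| <= K -> `|f x| <= B.
Proof.
move=> L0 HL; exists (`|f 0| + L * `|K| + 1) => [|x xK].
  by rewrite ltr_wpDl// addr_ge0// mulr_ge0.
have K0 : 0 <= K by rewrite (le_trans _ xK).
have := HL x 0 xK; rewrite normr0 => /(_ K0); rewrite subr0 => H.
have H2 : L * `|x| <= L * `|K| by rewrite ler_wpM2l// (le_trans xK)// ler_norm.
have := ler_normD (f x - f 0) (f 0); rewrite subrK; lra.
Qed.

(** Uniform on each ball, so that a constant is at hand for a prescribed bounded region; unlike a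
    global Lipschitz condition, this is stable under products and so covers polynomials. *)
Definition lipb U (f : U -> R) : Prop :=
  forall K : R, exists2 L : R, 0 <= L &
    forall x y, `|x| <= K -> `|y| <= K -> `|f x - f y| <= L * `|x - y|.

Lemma lipb_cst U (c : R) : lipb (fun _ : U => c).
Proof.
by move=> K; exists 0 => // x y _ _; rewrite subrr normr0 mul0r.
Qed.

Lemma lipbD U (f g : U -> R) : lipb f -> lipb g -> lipb (fun x => f x + g x).
Proof.
move=> hf hg K; have [L L0 HL] := hf K; have [M M0 HM] := hg K.
exists (L + M) => [|x y xK yK]; first exact: addr_ge0.
rewrite opprD addrACA mulrDl (le_trans (ler_normD _ _))// lerD//.
  exact: HL.
exact: HM.
Qed.

Lemma lipb_bounded U (f : U -> R) (K : R) :
  lipb f -> exists2 B : R, 0 < B & forall x, `|x| <= K -> `|f x| <= B.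
Proof.
by move=> /(_ K) [L L0 HL]; exact: lipschitz_bounded HL.
Qed.

Lemma lipbM U (f g : U -> R) : lipb f -> lipb g -> lipb (fun x => f x * g x).
Proof.
move=> hf hg K; have [L L0 HL] := hf K; have [M M0 HM] := hg K.
have [A A0 HA] := lipb_bounded K hf; have [B B0 HB] := lipb_bounded K hg.
exists (L * B + A * M) => [|x y xK yK].
  by rewrite addr_ge0// mulr_ge0// ltW.
rewrite (_ : _ - _ = (f x - f y) * g x + f y * (g x - g y)); last by ring.
apply: (le_trans (ler_normD _ _)); rewrite !normrM [leRHS]mulrDl lerD//.
  by rewrite mulrAC ler_pM// ?HL ?HB.
by rewrite -mulrA ler_pM// ?HA ?HM.
Qed.

Lemma lipb_sum U (I : Type) (r : seq I) (f : I -> U -> R) :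
  (forall i, lipb (f i)) -> lipb (fun x => \sum_(i <- r) f i x).
Proof.
move=> hf; elim: r => [|i r IH].
  under eq_fun do rewrite big_nil; exact: lipb_cst.
under eq_fun do rewrite big_cons; exact: lipbD.
Qed.

Lemma lipb_prod U (I : Type) (r : seq I) (f : I -> U -> R) :
  (forall i, lipb (f i)) -> lipb (fun x => \prod_(i <- r) f i x).
Proof.
move=> hf; elim: r => [|i r IH].
  under eq_fun do rewrite big_nil; exact: lipb_cst.
under eq_fun do rewrite big_cons; exact: lipbM.
Qed.

Lemma lipbX U (f : U -> R) k : lipb f -> lipb (fun x => f x ^+ k).
Proof.
move=> hf; elim: k => [|k IH]; first exact: lipb_cst.
under eq_fun do rewrite exprS; exact: lipbM.
Qed.

Lemma lipb_comp U V (h : U -> V) (f : V -> R) :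
  (forall x, `|h x| <= `|x|) -> (forall x y, `|h x - h y| <= `|x - y|) ->
  lipb f -> lipb (f \o h).
Proof.
move=> h0 h1 hf K; have [L L0 HL] := hf K.
exists L => // x y xK yK; rewrite (le_trans (HL _ _ _ _)) ?(le_trans (h0 _))//.
by rewrite ler_wpM2l.
Qed.

Lemma lipb_continuous U (f : U -> R) : lipb f -> continuous f.
Proof.
move=> hf x; have [L L0 HL] := hf (`|x| + 1).
by apply: (lipschitz_continuous_at L0) => y; apply: HL; rewrite lerDl.
Qed.

Lemma mx_norm_leP m n (A : 'M[R]_(m, n)) (c : R) : 0 <= c ->
  `|A| <= c <-> forall i j, `|A i j| <= c.
Proof.
move=> c0; rewrite [`|A|]/Num.Def.normr /= mx_normrE; split=> [H i j|H].
  apply: le_trans H; apply: (le_bigmax _ (fun ij => `|A ij.1 ij.2|) (i, j)).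
by apply: bigmax_le => // -[i j] _; exact: H.
Qed.

Lemma norm_entry_le m n (A : 'M[R]_(m, n)) i j : `|A i j| <= `|A|.
Proof. exact: (mx_norm_leP A (normr_ge0 _)).1. Qed.

Lemma lipb_entry n i : lipb (fun x : 'cV[R]_n => x i 0).
Proof.
move=> K; exists 1 => // x y _ _; rewrite mul1r.
by have := norm_entry_le (x - y) i 0; rewrite !mxE.
Qed.

Definition lipbmx U p q (F : U -> 'M[R]_(p, q)) : Prop :=
  forall i j, lipb (fun x => F x i j).

Lemma lipbmx_cst U p q (A : 'M[R]_(p, q)) : lipbmx (fun _ : U => A).
Proof. by move=> i j; exact: lipb_cst. Qed.

Lemma lipbmxD U p q (F G : U -> 'M[R]_(p, q)) :
  lipbmx F -> lipbmx G -> lipbmx (fun x => F x + G x).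
Proof.
by move=> hF hG i j; under eq_fun do rewrite mxE; exact: lipbD.
Qed.

Lemma lipbmxM U p q r (F : U -> 'M[R]_(p, q)) (G : U -> 'M[R]_(q, r)) :
  lipbmx F -> lipbmx G -> lipbmx (fun x => F x *m G x).
Proof.
move=> hF hG i j; under eq_fun do rewrite mxE.
by apply: lipb_sum => k; exact: lipbM.
Qed.

Lemma lipbmx_id n : lipbmx (fun x : 'cV[R]_n => x).
Proof. by move=> i j; rewrite (ord1 j); exact: lipb_entry. Qed.

Lemma lipbmx_fst (U V : normedModType R) p q (S : U -> 'M[R]_(p, q)) :
  lipbmx S -> lipbmx (fun z : U * V => S z.1).
Proof.
move=> hS i j; apply: (lipb_comp (h := fst) _ _ (hS i j)) => [x|x y].
  by rewrite prod_normE le_max lexx.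
by rewrite [leRHS]prod_normE le_max lexx.
Qed.

Lemma lipbmx_snd (U V : normedModType R) p q (S : V -> 'M[R]_(p, q)) :
  lipbmx S -> lipbmx (fun z : U * V => S z.2).
Proof.
move=> hS i j; apply: (lipb_comp (h := snd) _ _ (hS i j)) => [x|x y].
  by rewrite prod_normE le_max lexx orbT.
by rewrite [leRHS]prod_normE le_max lexx orbT.
Qed.

Lemma lipbmx_tr U p q (F : U -> 'M[R]_(p, q)) :
  lipbmx F -> lipbmx (fun x => (F x)^T).
Proof. by move=> hF i j; under eq_fun do rewrite mxE; exact: hF. Qed.

Lemma lipbmx_col U p1 p2 q (F : U -> 'M[R]_(p1, q)) (G : U -> 'M[R]_(p2, q)) :
  lipbmx F -> lipbmx G -> lipbmx (fun x => col_mx (F x) (G x)).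
Proof.
move=> hF hG i j; under eq_fun do rewrite mxE.
by case: splitP => k _; [exact: hF|exact: hG].
Qed.

Lemma lipbmx_lip U p q (F : U -> 'M[R]_(p, q)) : lipbmx F ->
  forall K : R, exists2 L : R, 0 < L &
    forall x y, `|x| <= K -> `|y| <= K -> `|F x - F y| <= L * `|x - y|.
Proof.
move=> hF K.
have /choice [L HL] : forall ij : 'I_p * 'I_q, exists L : R, 0 <= L /\
    forall x y, `|x| <= K -> `|y| <= K ->
      `|F x ij.1 ij.2 - F y ij.1 ij.2| <= L * `|x - y|.
  by move=> [i j]; have [L L0 HL] := hF i j K; exists L.
have S0 : 0 <= \sum_ij L ij by apply: sumr_ge0 => ij _; exact: (HL ij).1.
exists (1 + \sum_ij L ij) => [|x y xK yK]; first by rewrite ltr_pwDl.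
apply/mx_norm_leP => [|i j]; first by rewrite mulr_ge0// addr_ge0.
rewrite !mxE (le_trans ((HL (i, j)).2 _ _ xK yK))// ler_wpM2r//.
rewrite (bigD1 (i, j))//= addrCA lerDl addr_ge0// sumr_ge0// => ij _.
exact: (HL ij).1.
Qed.

Lemma lipbmx_continuous U p q (F : U -> 'M[R]_(p, q)) :
  lipbmx F -> continuous F.
Proof.
move=> hF x; have [L L0 HL] := lipbmx_lip hF (`|x| + 1).
by apply: (lipschitz_continuous_at (ltW L0)) => y; apply: HL; rewrite lerDl.
Qed.

Lemma lipbmx_bounded U p q (F : U -> 'M[R]_(p, q)) (K : R) : lipbmx F ->
  exists2 B : R, 0 < B & forall x, `|x| <= K -> `|F x| <= B.
Proof.
by move=> /lipbmx_lip /(_ K) [L L0 HL]; exact: lipschitz_bounded (ltW L0) HL.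
Qed.

Lemma lipbmx_locally_lipschitz U p q (F : U -> 'M[R]_(p, q)) : lipbmx F ->
  [locally [lipschitz F x | x in [set: U]]].
Proof.
move=> hF x _; have [L L0 HL] := lipbmx_lip hF (`|x| + 1).
exists L; split=> [|M LM]; first by rewrite num_real.
have H : \forall z \near x, `|z| <= `|x| + 1.
  near=> z; rewrite -[z](subKr x) (le_trans (ler_normB _ _))// lerD2l.
  by near: z; exact: cvgr_dist_le.
apply: filterS H => z zx _ /=.
have [z1 z2] : `|z.1| <= `|x| + 1 /\ `|z.2| <= `|x| + 1.
  by move: zx; rewrite prod_normE ge_max => /andP[].
by rewrite (le_trans (HL _ _ z1 z2))// ler_wpM2r// ltW.
Unshelve. all: by end_near. Qed.

Lemma polynomial_lipb n (f : 'cV[R]_n -> R) : polynomial_fun f -> lipb f.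
Proof.
move=> [p fE]; rewrite (funext fE); under eq_fun do rewrite mpoly.mevalE.
apply: lipb_sum => e; apply: lipbM; first exact: lipb_cst.
by apply: lipb_prod => i; apply: lipbX; exact: lipb_entry.
Qed.

Lemma polymx_lipb n p q (S : 'cV[R]_n -> 'M[R]_(p, q)) : polymx S -> lipbmx S.
Proof. by move=> hS i j; exact: polynomial_lipb. Qed.

Lemma monomial_lipb n (f : 'cV[R]_n -> R) : monomial_fun f -> lipb f.
Proof.
move=> [c [e fE]]; rewrite (funext fE).
apply: lipbM; first exact: lipb_cst.
by apply: lipb_prod => i; apply: lipbX; exact: lipb_entry.
Qed.

Lemma differentiable_entry n i (x : 'cV[R]_n) :
  differentiable (fun x : 'cV[R]_n => x i 0) x.
Proof. exact: differentiable_coord. Qed.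

Lemma polynomial_differentiable n (f : 'cV[R]_n -> R) x :
  polynomial_fun f -> differentiable f x.
Proof.
move=> [p fE]; rewrite (funext fE); under eq_fun do rewrite mpoly.mevalE.
elim: (mpoly.msupp p) => [|e r IH].
  under eq_fun do rewrite big_nil; exact: differentiable_cst.
under eq_fun do rewrite big_cons; apply: differentiableD => //.
apply: differentiableM; first exact: differentiable_cst.
elim: (index_enum _) => [|i s IH'].
  under eq_fun do rewrite big_nil; exact: differentiable_cst.
under eq_fun do rewrite big_cons; apply: differentiableM => //.
elim: (e i) => [|k IHk].
  under eq_fun do rewrite expr0; exact: differentiable_cst.
under eq_fun do rewrite exprS; apply: differentiableM => //.
exact: differentiable_entry.
Qed.

End LipschitzOnBoundedSets.

(** * Comparison functions *)

Section ComparisonFunctions.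
Context {R : realType}.
Implicit Types (a b : R -> R).

(* The bijections of [R] that extend class-K_oo functions: defining them on the
   whole line makes them closed under inversion without side conditions. *)
Definition kinf a : Prop :=
  [/\ continuous a, {homo a : x y / x < y}, a 0 = 0,
      forall M, exists s, M <= a s & forall M, exists s, a s <= M].

Lemma kinf_le a : kinf a -> {mono a : x y / x <= y}.
Proof. by move=> [_ H _ _ _]; exact: le_mono. Qed.

Lemma kinf_lt a : kinf a -> {mono a : x y / x < y}.
Proof. by move=> ka; apply: leW_mono; exact: kinf_le. Qed.

Lemma kinf_ge0 a s : kinf a -> 0 <= s -> 0 <= a s.
Proof. by move=> ka; have [_ _ a0 _ _] := ka; rewrite -{2}a0 kinf_le. Qed.

Lemma kinf_gt0 a s : kinf a -> 0 < s -> 0 < a s.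
Proof. by move=> ka; have [_ _ a0 _ _] := ka; rewrite -{2}a0 kinf_lt. Qed.

Lemma kinf_surj a : kinf a -> forall y, exists x, a x = y.
Proof.
move=> ka y; have [ca _ _ aup adn] := ka.
have [u yu] := aup y; have [l ly] := adn y.
have lu : l <= u by rewrite -(kinf_le ka) (le_trans ly).
have [|x _ <-] := @IVT _ a l u y lu (continuous_subspaceT ca); last by exists x.
by rewrite ge_min le_max ly yu orbT.
Qed.

Lemma kinf_inverse a : kinf a -> exists2 b, kinf b & cancel b a.
Proof.
move=> ka; have [ca homoa a0 aup adn] := ka.
have [b ba] := choice (kinf_surj ka); exists b => //.
have ab : cancel a b by move=> x; apply: (inc_inj (kinf_le ka)); rewrite ba.
split=> [y|x y|||].
- rewrite -[y]ba; apply: nbhs_singleton (near_can_continuous _ _).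
    by near=> z; exact: ab.
  by near=> z; exact: ca.
- by rewrite -[b x < _](kinf_lt ka) !ba.
- by rewrite -{1}a0 ab.
- by move=> M; exists (a M); rewrite ab.
- by move=> M; exists (a M); rewrite ab.
Unshelve. all: by end_near. Qed.

Lemma kinf_comp a b : kinf a -> kinf b -> kinf (a \o b).
Proof.
move=> ka kb; have [ca ha a0 au ad] := ka; have [cb hb b0 bu bd] := kb.
split=> [x|x y xy||M|M] /=.
- by apply: continuous_comp; [exact: cb|exact: ca].
- exact/ha/hb.
- by rewrite b0.
- have [s Ms] := au M; have [t st] := bu s.
  by exists t; rewrite (le_trans Ms)// kinf_le.
- have [s Ms] := ad M; have [t st] := bd s.
  by exists t; rewrite (le_trans _ Ms)// kinf_le.
Qed.

Lemma kinf_class_K a : kinf a -> class_K a.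
Proof.
move=> ka; have [ca ha a0 _ _] := ka; split=> //.
- exact: continuous_subspaceT.
- by move=> r; exact: kinf_ge0.
- by move=> r s _; exact: ha.
Qed.

(* [f <= kappa \o g] for some class-K_oo function [kappa]; see [dom_kinf]. *)
Definition dom (T : Type) (f g : T -> R) : Prop :=
  (forall e, 0 < e -> exists2 d, 0 < d & forall x, g x <= d -> f x <= e) /\
  (forall M, exists C, forall x, g x <= M -> f x <= C).

Lemma dom_trans (T : Type) (f g h : T -> R) : dom f g -> dom g h -> dom f h.
Proof.
move=> [fg1 fg2] [gh1 gh2]; split=> [e e0|M].
  have [d d0 H] := fg1 e e0; have [d' d'0 H'] := gh1 d d0.
  by exists d' => // x /H'/H.
have [C H] := gh2 M; have [C' H'] := fg2 C.
by exists C' => x /H/H'.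
Qed.

(* [h s = inf_x (g x + (s - f x)^+)] is monotone and 1-Lipschitz for free; the
   factor [s / (1 + s)] makes it strictly increasing. *)
Lemma dom_kinf (T : Type) (f g : T -> R) (x0 : T) :
  (forall x, 0 <= f x) -> (forall x, 0 <= g x) -> f x0 = 0 -> g x0 = 0 ->
  dom f g -> exists2 a, kinf a & forall x, a (f x) <= g x.
Proof.
move=> f0 g0 fx0 gx0 [fg1 fg2].
pose S (s : R) := [set g x + Num.max (s - f x) 0 | x in [set: T]].
pose h s := inf (S s).
have S0 s : S s !=set0 by exists (g x0 + Num.max (s - f x0) 0); exists x0.
have hlb s m : (forall x, m <= g x + Num.max (s - f x) 0) -> m <= h s.
  by move=> H; apply: lb_le_inf => // _ [x _ <-].
have hle s x : h s <= g x + Num.max (s - f x) 0.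
  apply: ge_inf; last by exists x.
  by exists 0 => _ [y _ <-]; rewrite addr_ge0// le_max lexx orbT.
have h0 s : 0 <= h s by apply: hlb => x; rewrite addr_ge0// le_max lexx orbT.
have hmono s t : s <= t -> h s <= h t /\ h t <= h s + (t - s).
  move=> st; split.
    apply: hlb => x; rewrite (le_trans (hle s x))// lerD2l.
    by rewrite ge_max !le_max lerD2r st lexx orbT.
  rewrite -lerBlDr; apply: hlb => x; have := hle t x.
  by rewrite /Num.max; case: ifPn; case: ifPn; lra.
have hf x : h (f x) <= g x.
  by rewrite (le_trans (hle _ x))// subrr maxxx addr0.
have hmax s : h s <= Num.max s 0.
  by rewrite (le_trans (hle _ x0))// gx0 fx0 add0r subr0.
have hneg s : s <= 0 -> h s = 0.
  move=> s0; apply/le_anti; rewrite h0 andbT (le_trans (hmax s))//.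
  by rewrite max_r.
have hpos s : 0 < s -> 0 < h s.
  move=> s0; have s20 : 0 < s / 2 by rewrite divr_gt0.
  have [d d0 H] := fg1 _ s20.
  (* If [g x <= d] then [f x <= s / 2], which leaves [s - f x] at least [s / 2]; otherwise [g x]
     itself exceeds [d]. *)
  apply: (@lt_le_trans _ _ (Num.min d (s / 2))); first by rewrite lt_min d0.
  apply: hlb => x; case: (leP (g x) d) => [/H fx|dx].
    rewrite ge_min; apply/orP; right; rewrite ler_wpDl// le_max; apply/orP.
    by left; lra.
  by rewrite ge_min ler_wpDr ?le_max ?lexx ?orbT// ltW.
have hup M : exists2 s, 0 <= s & M <= h s.
  have [C HC] := fg2 M; exists (Num.max 0 (C + M)); first by rewrite le_max lexx.
  apply: hlb => x; case: (leP (g x) M) => [/HC fC|Mx].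
    rewrite ler_wpDl// le_max; apply/orP; left.
    by rewrite lerBrDr (le_trans _ (_ : C + M <= _)) ?le_max ?lexx ?orbT//; lra.
  by rewrite ler_wpDr ?le_max ?lexx ?orbT// ltW.
have hlip : forall x y, `|h x - h y| <= 1 * `|x - y|.
  move=> x y; rewrite mul1r; wlog xy : x y / x <= y => [H|].
    by case: (leP x y) => [/H//|/ltW/H]; rewrite distrC (distrC y).
  have [H1 H2] := hmono _ _ xy.
  by rewrite distrC ger0_norm ?subr_ge0// distrC ger0_norm ?subr_ge0//; lra.
(* The last term is [min s 0]: it makes [a] the identity on the negative half-line, where [h]
   vanishes. *)
pose a s := h s * (`|s| / (1 + `|s|)) + (s - `|s|) / 2.
have aneg s : s <= 0 -> a s = s.
  by move=> s0; rewrite /a hneg// mul0r add0r ler0_norm// opprK; lra.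
have apos s : 0 <= s -> a s = h s * (s / (1 + s)).
  by move=> s0; rewrite /a ger0_norm// subrr mul0r addr0.
have s1 (s : R) : 0 <= s -> 0 <= s / (1 + s) < 1.
  by move=> s0; rewrite divr_ge0 ?addr_ge0//= ltr_pdivrMr ?ltr_wpDr// mul1r ltrDr.
exists a => [|x]; last first.
  rewrite apos// (le_trans _ (hf x))// ler_piMr//.
  by have /andP[_ /ltW] := s1 _ (f0 x).
split.
- move=> s; rewrite /a; apply: cvgD.
    apply: cvgM; first exact: (lipschitz_continuous hlip).
    apply: cvgM; first exact: cvg_norm.
    apply: cvgV; first by rewrite gt_eqF// ltr_wpDr.
    by apply: cvgD; [exact: cvg_cst|exact: cvg_norm].
  apply: cvgM; last exact: cvg_cst.
  by apply: cvgB; [exact: cvg_id|exact: cvg_norm].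
- move=> s t st; case: (leP t 0) => [t0|t0].
    by rewrite !aneg// (le_trans (ltW st)).
  case: (leP s 0) => [s0|s0].
    rewrite (aneg s s0) (le_lt_trans s0)// apos ?ltW// mulr_gt0 ?hpos//.
    by rewrite divr_gt0// ltr_wpDl// ltW.
  rewrite !apos ?ltW//; apply: (@le_lt_trans _ _ (h t * (s / (1 + s)))).
    rewrite ler_wpM2r ?(hmono _ _ (ltW st)).1//.
    by have /andP[] := s1 _ (ltW s0).
  rewrite ltr_pM2l ?hpos// -subr_gt0.
  have -> : t / (1 + t) - s / (1 + s) = (t - s) / ((1 + t) * (1 + s)).
    by field; rewrite !gt_eqF ?ltr_pwDl// ltW.
  by rewrite divr_gt0 ?subr_gt0// mulr_gt0 ?ltr_pwDl// ltW.
- by rewrite aneg.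
(* From 1 on, the factor [s / (1 + s)] is at least 1/2; hence the doubled target for [h]. *)
- move=> M; have [s s0 Ms] := hup (2 * `|M|); exists (Num.max s 1).
  have m1 : 1 <= Num.max s 1 by rewrite le_max lexx orbT.
  have m0 : 0 <= Num.max s 1 by rewrite (le_trans _ m1).
  have hm : 2 * `|M| <= h (Num.max s 1).
    by rewrite (le_trans Ms)// (hmono _ _ _).1// le_max lexx.
  rewrite apos// (le_trans (ler_norm M))//.
  have : 1 / 2 <= Num.max s 1 / (1 + Num.max s 1).
    by rewrite ler_pdivlMr ?ltr_pwDl//; lra.
  by have := normr_ge0 M; nra.
- move=> M; exists (Num.min M 0).
  by rewrite aneg ?ge_min ?lexx ?orbT.
Qed.

(* [phi r t] is the [s] such that [s + t * a s = r]. *)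
Lemma decay_function a : kinf a -> exists phi : R -> R -> R,
  (forall r t, 0 <= r -> 0 <= t -> phi r t + t * a (phi r t) = r) /\
  (forall w k : R -> R, kinf w -> kinf k ->
     class_KL (fun r t => k (phi (w `|r|) `|t|))).
Proof.
move=> ka; have [ca ha a0 aup adn] := ka.
have kt (t : R) : 0 <= t -> kinf (fun s => s + t * a s).
  move=> t0; split=> [s|x y xy||M|M] /=.
  - by apply: cvgD; [exact: cvg_id|apply: cvgMr; exact: ca].
  - by rewrite ltr_leD// ler_wpM2l// ltW// ha.
  - by rewrite a0 mulr0 addr0.
  - exists `|M|; rewrite (le_trans (ler_norm M))// lerDl mulr_ge0//.
    exact: kinf_ge0.
  - exists (- `|M|).
    have : a (- `|M|) <= 0 by rewrite -[leRHS]a0 kinf_le// oppr_le0.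
    by move=> am; have := ler_norm (- M); rewrite normrN; nra.
(* The value 0 at negative times is a default that is never met, since time enters the final
   function through its absolute value. *)
have /choice[phi Hphi] : forall rt : R * R, exists s,
    0 <= rt.2 -> s + rt.2 * a s = rt.1.
  move=> [r t] /=; case: (leP 0 t) => [t0|_]; last by exists 0.
  by have [s sr] := kinf_surj (kt _ t0) r; exists s.
have eq_phi (r t : R) : 0 <= t -> phi (r, t) + t * a (phi (r, t)) = r := Hphi (r, t).
exists (fun r t => phi (r, t)); split=> [r t _ t0|w k kw kk]; first exact: eq_phi.
have [cw hw w0 _ _] := kw; have [ck hk k0 _ _] := kk.
have phi_le (r r' t : R) : 0 <= t -> r <= r' -> phi (r, t) <= phi (r', t).
  by move=> t0; rewrite -[phi _ <= _](kinf_le (kt _ t0)) !eq_phi.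
have phi_lt (r r' t : R) : 0 <= t -> r < r' -> phi (r, t) < phi (r', t).
  by move=> t0; rewrite -[phi _ < _](kinf_lt (kt _ t0)) !eq_phi.
have phi0 (t : R) : 0 <= t -> phi (0, t) = 0.
  by move=> t0; apply: (inc_inj (kinf_le (kt _ t0))); rewrite eq_phi// a0 mulr0 addr0.
have phi_ge0 (r t : R) : 0 <= r -> 0 <= t -> 0 <= phi (r, t).
  by move=> r0 t0; rewrite -(phi0 _ t0) phi_le.
have phi_ler (r t : R) : 0 <= r -> 0 <= t -> phi (r, t) <= r.
  move=> r0 t0; rewrite -{2}(eq_phi r t t0) lerDl mulr_ge0//.
  by apply: kinf_ge0 => //; exact: phi_ge0.
(* Subtracting the two defining equations gives phi(r, t) - phi(r, t') = t' a(phi(r, t')) - t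
   a(phi(r, t)), which is at most (t' - t) a(phi(r, t')) by monotonicity of [a]. *)
have phi_t (r t t' : R) : 0 <= r -> 0 <= t -> t <= t' ->
    phi (r, t') <= phi (r, t) <= phi (r, t') + (t' - t) * a r.
  move=> r0 t0 tt'; have t'0 := le_trans t0 tt'.
  have E := eq_phi r t t0; have E' := eq_phi r t' t'0.
  have p' := phi_ge0 _ _ r0 t'0.
  have H1 : phi (r, t') <= phi (r, t).
    rewrite -[phi _ <= _](kinf_le (kt _ t0)) E -[leRHS]E' lerD2l ler_wpM2r//.
    exact: kinf_ge0.
  rewrite H1 /=.
  have A1 : a (phi (r, t')) <= a (phi (r, t)) by rewrite kinf_le.
  have A2 : a (phi (r, t')) <= a r by rewrite kinf_le// phi_ler.
  by nra.
have phi_r (r r' t : R) : 0 <= t -> r <= r' -> phi (r', t) <= phi (r, t) + (r' - r).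
  move=> t0 rr'; have := phi_le _ _ _ t0 rr'; rewrite -(kinf_le ka) => A1.
  by have := eq_phi r t t0; have := eq_phi r' t t0; nra.
(* [phi] is 1-Lipschitz in [r], and Lipschitz in [t] with constant [a r]; together these give joint
   continuity. *)
have phi_cont : continuous (fun z : R * R => phi (`|z.1|, `|z.2|)).
  have H (r r' t t' : R) : 0 <= r -> 0 <= r' -> 0 <= t -> 0 <= t' ->
      `|phi (r, t) - phi (r', t')| <= `|t - t'| * a r + `|r - r'|.
    move=> r0 r'0 t0 t'0.
    rewrite (_ : _ - _ = phi (r, t) - phi (r, t') + (phi (r, t') - phi (r', t')));
      last by ring.
    rewrite (le_trans (ler_normD _ _))// lerD//.
      case: (leP t t') => tt'.
        have /andP[H1 H2] := phi_t _ _ _ r0 t0 tt'.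
        rewrite ger0_norm ?subr_ge0// (distrC t) (ger0_norm (_ : 0 <= t' - t)) ?subr_ge0//.
        by rewrite lerBlDl.
      have /andP[H1 H2] := phi_t _ _ _ r0 t'0 (ltW tt').
      rewrite distrC ger0_norm ?subr_ge0// (ger0_norm (_ : 0 <= t - t')).
        by rewrite lerBlDl.
      by rewrite subr_ge0 ltW.
    case: (leP r r') => rr'.
      rewrite distrC ger0_norm ?subr_ge0 ?phi_le// distrC ger0_norm ?subr_ge0//.
      by rewrite lerBlDl phi_r.
    have {}rr' := ltW rr'.
    rewrite ger0_norm ?subr_ge0 ?phi_le// ger0_norm ?subr_ge0//.
    by rewrite lerBlDl phi_r.
  move=> z; apply/cvgrPdist_le => e e0.
  have az : 0 <= a `|z.1| by exact: kinf_ge0.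
  have e1 : 0 < e / (a `|z.1| + 1) by rewrite divr_gt0// ltr_wpDl.
  near=> y.
  have zy : `|z - y| <= e / (a `|z.1| + 1) by near: y; exact: cvgr_dist_le.
  move: zy; rewrite prod_normE ge_max /= => /andP[zy1 zy2].
  rewrite (le_trans (H _ _ _ _ _ _ _ _))//.
  have {}zy1 := le_trans (ler_dist_dist _ _) zy1.
  have {}zy2 := le_trans (ler_dist_dist _ _) zy2.
  have := ler_wpM2r az zy2.
  have : e / (a `|z.1| + 1) * (a `|z.1| + 1) = e.
    by rewrite divfK// gt_eqF// ltr_wpDl.
  by lra.
have kphi_cont : continuous (fun z : R * R => k (phi (w `|z.1|, `|z.2|))).
  move=> z; apply: continuous_comp; last exact: ck.
  rewrite (_ : (fun z : R * R => phi (w `|z.1|, `|z.2|)) =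
    (fun z : R * R => phi (`|z.1|, `|z.2|)) \o (fun z => (w `|z.1|, z.2))).
    apply: continuous_comp; last exact: phi_cont.
    apply: (@cvg_pair _ _ _ _ (nbhs (w `|z.1|)) (nbhs z.2)); last exact: cvg_snd.
    apply: continuous_comp; last exact: cw.
    by apply: continuous_comp; [exact: cvg_fst|exact: norm_continuous].
  by apply/funext => y /=; rewrite [`|w _|]ger0_norm ?(kinf_ge0 kw).
split.
- exact: continuous_subspaceT kphi_cont.

- move=> t t0; rewrite (ger0_norm t0); split.
  + apply: continuous_subspaceT => r.
    have -> : (fun r => k (phi (w `|r|, t))) =
        (fun z : R * R => k (phi (w `|z.1|, `|z.2|))) \o (fun r => (r, t)).
      by apply/funext => y /=; rewrite (ger0_norm t0).
    apply: continuous_comp; last exact: kphi_cont.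
    by apply: (@cvg_pair _ _ _ _ (nbhs r) (nbhs t)); [exact: cvg_id|exact: cvg_cst].
  + by move=> r r0; rewrite kinf_ge0// phi_ge0// kinf_ge0.
  + move=> r s r0 rs; rewrite hk// phi_lt// (ger0_norm r0) ger0_norm ?hw//.
    by rewrite (le_trans r0)// ltW.
  + by rewrite normr0 w0 phi0.
- move=> r s t r0 s0 st; rewrite (ger0_norm s0) (ger0_norm (le_trans s0 st)).
  by rewrite kinf_le//; have /andP[] := phi_t (w `|r|) s t (kinf_ge0 kw (normr_ge0 r)) s0 st.
- move=> r r0; rewrite -[X in _ --> X]k0; apply: continuous_cvg; first exact: ck.
  apply/cvgrPdist_le => e e0; near=> t.
  have t0 : 0 <= t by near: t; exact: nbhs_pinfty_ge.
  have wr : 0 <= w `|r| by exact: kinf_ge0.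
  rewrite sub0r normrN (ger0_norm t0) ger0_norm ?phi_ge0//.
  rewrite leNgt; apply/negP => ephi.
  (* Beyond this time, phi > e would make phi + t a(phi) exceed t a(e) >= w(|r|), against the
     defining equation. *)
  have te : w `|r| / a e <= t by near: t; apply: nbhs_pinfty_ge; exact: num_real.
  have ae : 0 < a e by exact: kinf_gt0.
  move: te; rewrite ler_pdivrMr// => te.
  have := eq_phi (w `|r|) t t0.
  have : a e <= a (phi (w `|r|, t)) by rewrite kinf_le// ltW.
  by nra.
Unshelve. all: by end_near. Qed.

End ComparisonFunctions.

(** * Differential inequalities *)

Section DifferentialInequalities.
Context {R : realType}.
Implicit Types (f u : R -> R) (D : set R).

(** Models the continuity times of a piecewise continuous input: finitely many exceptions before
    each horizon, possibly infinitely many in all. *)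
Definition cofin D : Prop :=
  forall T : R, finite_set [set t : R | [/\ 0 < t, t < T & ~ D t]].

(** Induction on the exceptional points: one inside the interval splits it, and continuity up to the
    endpoints lets the two inequalities be chained; one outside is discarded. *)
Lemma nonincreasing_seq_exc (s : seq R) f (a b : R) :
  {within `[a, b], continuous f} ->
  (forall t, a < t < b -> t \notin s ->
     exists2 df, is_derive t 1 f df & df <= 0) ->
  a <= b -> f b <= f a.
Proof.
elim: s a b => [|c s IH] a b cf df ab.
  apply: (@ler0_derive1_le_cc _ f a b) => //; rewrite ?in_itv/= ?lexx ?ab//.
    by move=> t; rewrite in_itv => /df[]// d fd _; exact: ex_derive.
  by move=> t; rewrite in_itv => /df[]// d fd d0; rewrite derive1E derive_val.
have [cab|cab] := boolP (a < c < b); last first.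
  apply: IH => // t tab ts; apply: df => //; rewrite inE negb_or ts andbT.
  by apply: contra cab => /eqP <-.
have /andP[ac cb] := cab.
apply: (@le_trans _ _ (f c)).
  apply: IH; last exact: ltW.
    by apply: continuous_subspaceW cf; apply: subset_itvr; rewrite bnd_simp ltW.
  move=> t /andP[ct tb] ts; apply: df; first by rewrite (lt_trans ac).
  by rewrite inE negb_or ts andbT gt_eqF.
apply: IH; last exact: ltW.
  by apply: continuous_subspaceW cf; apply: subset_itvl; rewrite bnd_simp ltW.
move=> t /andP[at_ tc] ts; apply: df; first by rewrite at_ (lt_trans tc).
by rewrite inE negb_or ts andbT lt_eqF.
Qed.

Lemma nonincreasing_cofin D f (a b : R) : cofin D -> 0 <= a ->
  {within `[0, +oo[, continuous f} ->
  (forall t, a < t < b -> D t -> exists2 df, is_derive t 1 f df & df <= 0) ->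
  a <= b -> f b <= f a.
Proof.
move=> cD a0 cf df ab; have /finite_seqP[s sE] := cD b.
apply: (@nonincreasing_seq_exc s) => //.
  apply: continuous_subspaceW cf => t /=; rewrite !in_itv/= andbT => /andP[at_ _].
  exact: le_trans at_.
move=> t /andP[at_ tb] ts; apply: df; first by rewrite at_.
apply: contrapT => Dt; move/negP: ts; apply.
have : [set` s] t by rewrite -sE /=; split=> //; exact: le_lt_trans at_.
by [].
Qed.

(** Squaring makes the positive part differentiable at 0 too, where the difference quotient is at
    most [|h|]. *)
Lemma is_derive_sqr_pos_part (x : R) :
  is_derive x 1 (fun y : R => Num.max y 0 ^+ 2) (2 * Num.max x 0).
Proof.
have [x0|x0|->] := ltgtP x 0.
- rewrite mulr0; apply: (near_eq_is_derive _ (is_derive_cst (0 : R) x 1)) => //.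
  near=> y; rewrite max_r ?expr0n//; apply: ltW.
  by near: y; exact: lt_nbhsl.
- apply: (@near_eq_is_derive _ _ _ (fun y : R => y * y)).
    near=> y; rewrite max_l ?expr2//; apply: ltW.
    by near: y; exact: lt_nbhsr.
  by apply: is_derive_eq; rewrite [_ *: _]mulr1 mulr_natl.
- have H : (h : R)^-1 *: (Num.max (h *: (1 : R) + 0) 0 ^+ 2 - Num.max (0 : R) 0 ^+ 2)
      @[h --> (0 : R)^'] --> (0 : R).
    apply/cvgrPdist_le => e e0; near=> h.
    have he : `|h| <= e by near: h; exact: dnbhs0_le.
    have h0 : h != 0 by near: h; exact: nbhs_dnbhs_neq.
    rewrite sub0r normrN maxxx expr0n subr0 [h *: 1]mulr1 addr0 normrM normrX.
    rewrite normfV ler_pdivrMl ?normr_gt0// mulrC.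
    have m0 : 0 <= Num.max h 0 by rewrite le_max lexx orbT.
    have mh : Num.max h 0 <= `|h| by rewrite ge_max ler_norm normr_ge0.
    by rewrite (ger0_norm m0) expr2 ler_pM// (le_trans mh).
  apply: DeriveDef; first by apply/cvg_ex; exists 0; exact: H.
  by rewrite mulr0; apply/cvg_lim => //; exact: H.
Unshelve. all: by end_near. Qed.

(** The squared positive part of [u - c] has derivative 2 (u - c)^+ u', which is nonpositive above
    the level and zero at or below it. Being nonincreasing and 0 at [a], it stays 0; no crossing
    time has to be analysed. *)
Lemma barrier D u (c a b : R) : cofin D -> 0 <= a ->
  {within `[0, +oo[, continuous u} ->
  (forall t, 0 < t -> D t -> c < u t ->
     exists2 du, is_derive t 1 u du & du <= 0) ->
  (forall t, 0 < t -> D t -> derivable u t 1) ->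
  u a <= c -> a <= b -> u b <= c.
Proof.
move=> cD a0 cu du dru uac ab.
pose w t := Num.max (u t - c) 0 ^+ 2.
have wa : w a = 0 by rewrite /w max_r ?expr0n// subr_le0.
have : w b <= w a.
  apply: (@nonincreasing_cofin D) => //.
    have cp : continuous (fun y : R => Num.max (y - c) 0 ^+ 2).
      move=> y; apply: (@continuous_comp _ _ _ (fun y => Num.max (y - c) 0) (fun y => y ^+ 2));
        last exact: exprn_continuous.
      apply: (@continuous_max _ _ (fun y => y - c)).
        by apply: cvgB; [exact: cvg_id|exact: cvg_cst].
      exact: cvg_cst.
    move=> t; exact: (continuous_comp (cu t) (cp (u t))).
  move=> t /andP[at_ _] Dt; have t0 := le_lt_trans a0 at_.
  have uw d : is_derive t 1 u d -> is_derive t 1 w (d * (2 * Num.max (u t - c) 0)).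
    move=> ud; have ucd : is_derive t 1 (fun t => u t - c) d.
      by apply: is_derive_eq; rewrite subr0.
    rewrite mulrC.
    exact: (@is_derive1_comp _ _ (fun t => u t - c) _ _ _ (is_derive_sqr_pos_part _) ucd).
  have [tc|ct] := leP (u t) c; last first.
    have [d ud d0] := du t t0 Dt ct.
    exists (d * (2 * Num.max (u t - c) 0)); first exact: uw.
    by rewrite mulr_le0_ge0// mulr_ge0// le_max lexx orbT.
  have /derivableP ud := dru t t0 Dt.
  exists ('D_1 u t * (2 * Num.max (u t - c) 0)); first exact: uw.
  by rewrite max_r ?mulr0// subr_le0.
rewrite wa leNgt => wb; rewrite leNgt; apply: contra wb => cb.
by rewrite /w exprn_gt0// lt_max subr_gt0 cb.
Qed.

(** Suppose [u t > c]. By [barrier], [u] has been above [c] since time 0; there its derivative is at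
    most -2 al(c) + s <= -al(c), so [u] has lost at least t al(c) and cannot exceed [c]. Fixing the
    level in advance allows it to be a maximum of a transient and an asymptotic value. *)
Lemma decay_estimate D u al (s c t : R) : cofin D -> kinf al ->
  {within `[0, +oo[, continuous u} ->
  (forall t, 0 < t -> D t ->
     exists2 du, is_derive t 1 u du & du <= - 2 * al (u t) + s) ->
  0 <= t -> 0 <= c -> s <= al c -> u 0 <= c + t * al c -> u t <= c.
Proof.
move=> cD kal cu du t0 c0 sc u0; rewrite leNgt; apply/negP => cut.
have key r : 0 < r -> D r -> c < u r ->
    exists2 du, is_derive r 1 u du & du <= - al c.
  move=> r0 Dr cr; have [d ud dle] := du r r0 Dr; exists d => //.
  by move: cr; rewrite -(kinf_lt kal); lra.
have alc : 0 <= al c by exact: kinf_ge0.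
have above r : 0 <= r <= t -> c < u r.
  move=> /andP[r0 rt]; rewrite ltNge; apply/negP => ur.
  move: cut; apply/negP; rewrite -leNgt.
  apply: (barrier cD r0 cu) ur rt => [q q0 Dq cq|q q0 Dq].
    have [d ud dle] := key q q0 Dq cq; exists d => //.
    by rewrite (le_trans dle)// oppr_le0.
  by have [d ud _] := du q q0 Dq; exact: ex_derive.
have : u t + t * al c <= u 0 + 0 * al c.
  apply: (@nonincreasing_cofin D (fun r => u r + r * al c)) => //.
    move=> r; apply: cvgD; first exact: cu.
    apply: cvgM; last exact: cvg_cst.
    by apply: continuous_subspaceT => q; exact: cvg_id.
  move=> r /andP[r0 rt] Dr.
  have [|d ud dle] := key r r0 Dr; first by apply: above; rewrite !ltW.
  exists (d + al c); last by lra.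
  by apply: is_derive_eq; rewrite scaler0 add0r [_ *: _]mulr1.
by lra.
Qed.

End DifferentialInequalities.

(** * Primitives and global solutions *)

Section Primitives.
Context {R : realType}.
Implicit Types (D : set R).
Notation mu := (@lebesgue_measure R).

(** Setting [g] to 0 off the open set [D] gives a bounded measurable function, whatever [g] is
    elsewhere. Its integral from 0 is Lipschitz, and the fundamental theorem of calculus applies at
    each point of [D]. For [t <= 0] the domain of integration is empty or a point. *)
Lemma bounded_primitive D (g : R -> R) (B : R) :
  open D -> D `<=` [set t | 0 < t] ->
  (forall t, D t -> {for t, continuous g}) -> (forall t, D t -> `|g t| <= B) ->
  0 <= B ->
  exists G : R -> R, [/\ forall t, t <= 0 -> G t = 0,
    forall s t, `|G s - G t| <= B * `|s - t|
    & forall t, D t -> is_derive t 1 G (g t)].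
Proof.
move=> oD D0 cg gB B0.
pose f := g \_ D.
have mD : measurable D by exact: open_measurable.
have mf : measurable_fun [set: R] f.
  apply: (measurable_restrictT _ mD).1; apply: open_continuous_measurable_fun => //.
  by move=> t /set_mem; exact: cg.
have fB t : `|f t| <= B.
  rewrite /f patchE; case: ifPn => [|_]; last by rewrite normr0.
  by rewrite inE; exact: gB.
have intf (i : interval R) : (mu [set` i] < +oo)%E ->
    mu.-integrable [set` i] (EFin \o f).
  move=> fin; apply: measurable_bounded_integrable => //.
    exact: measurable_funS mf.
  exists B; split; first exact: num_real.
  by move=> M BM t _ /=; rewrite (le_trans (fB t))// ltW.
have fin_cc (a b : R) : (mu `[a, b] < +oo)%E.
  by rewrite lebesgue_measure_itv/=; case: ifP => _; rewrite ?ltry// -EFinB ltry.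
have fin_oc (a b : R) : (mu `]a, b] < +oo)%E.
  by rewrite lebesgue_measure_itv/=; case: ifP => _; rewrite ?ltry// -EFinB ltry.
pose G t := \int[mu]_(x in `[0, t]) f x.
have G0 t : t <= 0 -> G t = 0.
  rewrite le_eqVlt => /predU1P[->|t0]; rewrite /G.
    by rewrite set_itv1 Rintegral_set1.
  by rewrite set_itv_ge ?Rintegral_set0// bnd_simp -ltNge.
have Glip0 s t : 0 <= s -> s <= t -> `|G t - G s| <= B * (t - s).
  move=> s0 st; rewrite /G Rintegral_itvB ?bnd_simp//; last exact/intf/fin_cc.
  have iB : mu.-integrable `]s, t] (EFin \o cst B).
    apply: measurable_bounded_integrable => //; first exact: fin_oc.
    by exists B; split; [exact: num_real|move=> M BM x _ /=; rewrite ger0_norm// ltW].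
  have If := intf _ (fin_oc s t).
  apply: (le_trans (le_normr_Rintegral _ If)) => //.
  apply: (@le_trans _ _ (\int[mu]_(x in `]s, t]) B)).
    apply: le_Rintegral => //.
    exact: (integrable_norm If).
  rewrite Rintegral_cst// [X in fine X](_ : _ = mu `]s, t])//.
  rewrite lebesgue_measure_itv/=; case: ifPn => //= _.
  by rewrite mulr0 mulr_ge0// subr_ge0.
have Glip1 s t : s <= t -> `|G t - G s| <= B * (t - s).
  move=> st; have [s0|s0] := leP 0 s; first exact: Glip0.
  have [t0|t0] := leP t 0.
    by rewrite (G0 _ t0) (G0 _ (ltW s0)) subrr normr0 mulr_ge0// subr_ge0.
  rewrite (G0 s (ltW s0)) -(G0 0 (lexx _)); apply: (le_trans (Glip0 _ _ (lexx _) (ltW t0))).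
  by rewrite ler_wpM2l// lerD2l lerN2 ltW.
exists G; split=> // [s t|t Dt].
  have [st|ts] := leP s t.
    by rewrite distrC (le_trans (Glip1 _ _ st))// distrC ger0_norm ?subr_ge0.
  by rewrite (le_trans (Glip1 _ _ (ltW ts)))// ger0_norm ?subr_ge0// ltW.
have nD : \forall x \near t, D x by exact: open_nbhs_nbhs.
have ft : f t = g t by rewrite /f patchE mem_set.
have cf : {for t, continuous f}.
  rewrite /prop_for /continuous_at ft; apply: cvg_trans (cg t Dt).
  apply: near_eq_cvg; near=> x; rewrite /f patchE mem_set//; near: x.
  exact: nD.
have tt1 : t < t + 1 by rewrite ltrDl.
have [dG GE] := continuous_FTC1_closed tt1 (intf _ (fin_cc 0 (t + 1))) (D0 _ Dt) cf.
by apply: DeriveDef; [exact: dG|rewrite -derive1E GE].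
Unshelve. all: by end_near. Qed.

Lemma is_derive_mx m n (M : R -> 'M[R]_(m, n)) (dM : 'M[R]_(m, n)) (t : R) :
  (forall i j, is_derive t 1 (fun s => M s i j) (dM i j)) <->
  is_derive t 1 M dM.
Proof.
split=> [H|H i j].
  have dr : derivable M t 1 by apply/derivable_mxP => i j; exact: ex_derive.
  apply: DeriveDef => //; rewrite derive_mx//; apply/matrixP => i j.
  by rewrite mxE derive_val.
have dr : derivable M t 1 by exact: ex_derive.
apply: DeriveDef; first by move/derivable_mxP : dr.
by have := derive_val (is_derive := H); rewrite derive_mx// => <-; rewrite mxE.
Qed.

Lemma bounded_primitive_mx n D (g : R -> 'cV[R]_n) (B : R) :
  open D -> D `<=` [set t | 0 < t] ->
  (forall t, D t -> {for t, continuous g}) -> (forall t, D t -> `|g t| <= B) ->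
  0 <= B ->
  exists G : R -> 'cV[R]_n, [/\ forall t, t <= 0 -> G t = 0,
    forall s t, `|G s - G t| <= B * `|s - t|
    & forall t, D t -> is_derive t 1 G (g t)].
Proof.
move=> oD D0 cg gB B0.
have /choice[G HG] : forall i, exists Gi : R -> R, [/\ forall t, t <= 0 -> Gi t = 0,
    forall s t, `|Gi s - Gi t| <= B * `|s - t|
    & forall t, D t -> is_derive t 1 Gi (g t i 0)].
  move=> i; apply: bounded_primitive => // t Dt.
    exact: (continuous_comp (cg t Dt) (@coord_continuous _ _ _ i 0 _)).
  exact: (le_trans (norm_entry_le _ _ _) (gB t Dt)).
exists (fun t => \col_i G i t); split=> [t t0|s t|t Dt].
- by apply/colP => i; rewrite !mxE; have [->] := HG i.
- apply/mx_norm_leP => [|i j]; first exact: mulr_ge0.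
  by rewrite !mxE; have [_ + _] := HG i.
- apply/is_derive_mx => i j; rewrite (ord1 j).
  under eq_fun do rewrite mxE.
  by have [_ _] := HG i; exact.
Qed.

Lemma lip_entry_continuous n (f : R -> 'cV[R]_n) (B : R) i :
  (forall s t, `|f s - f t| <= B * `|s - t|) -> continuous (fun t => f t i 0).
Proof.
move=> H; apply: (@lipschitz_continuous _ _ _ _ B) => s t.
by have := norm_entry_le (f s - f t) i 0; rewrite !mxE => /le_trans; apply.
Qed.

(** The bound on u' is exactly the derivative of [C * expR (lam * t)], so subtracting this function
    from [u] or from [- u] leaves a nonincreasing function. *)
Lemma exponential_bound D (u : R -> R) (C lam : R) : cofin D -> continuous u ->
  (forall t, 0 < t -> D t ->
     exists2 du, is_derive t 1 u du & `|du| <= lam * C * expR (lam * t)) ->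
  `|u 0| <= C -> forall t, 0 <= t -> `|u t| <= C * expR (lam * t).
Proof.
move=> cD cu du u0 t t0.
have dexp (s : R) : is_derive s 1 (fun s => C * expR (lam * s)) (lam * C * expR (lam * s)).
  have d1 : is_derive s 1 (fun s : R => lam * s) lam.
    by apply: is_derive_eq; rewrite [_ *: _]mulr1.
  have d2 := @is_derive1_comp _ _ _ _ _ _ (is_derive_expR (lam * s)) d1.
  have d3 := is_deriveZ C d2.
  by rewrite (_ : lam * C * _ = C *: (expR (lam * s) * lam))// [RHS]mulrC mulrC; ring.
have cexp : continuous (fun s : R => C * expR (lam * s)).
  by move=> s; apply/differentiable_continuous/derivable1_diffP; exact: ex_derive.
have H (v : R -> R) : continuous v -> `|v 0| <= C ->
    (forall t, 0 < t -> D t ->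
     exists2 dv, is_derive t 1 v dv & `|dv| <= lam * C * expR (lam * t)) ->
    v t <= C * expR (lam * t).
  move=> cv v0 dv; rewrite -subr_le0.
  apply: (@le_trans _ _ (v 0 - C * expR (lam * 0))); last first.
    by rewrite mulr0 expR0 mulr1 subr_le0 (le_trans (ler_norm _)).
  apply: (@nonincreasing_cofin _ D (fun t => v t - C * expR (lam * t))) => //.
    apply: continuous_subspaceT => s.
    by apply: (@continuousB _ _ _ v); [exact: cv|exact: cexp].
  move=> s /andP[s0 _] Ds; have [d vd dle] := dv s s0 Ds.
  exists (d - lam * C * expR (lam * s)).
    exact: (is_deriveB vd (dexp s)).
  by rewrite subr_le0 (le_trans (ler_norm _)).
rewrite ler_norml lerNl; apply/andP; split; last exact: H.
apply: (H (fun t => - u t)) => [s||s s0 Ds].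
- by apply: cvgN; exact: cu.
- by rewrite normrN.
- have [d ud dle] := du s s0 Ds; exists (- d); last by rewrite normrN.
  exact: (is_deriveN ud).
Qed.

(** * Geometric convergence and Picard iteration *)

Lemma ler_geometric (a b c : R) : (forall k, a <= b + c * 2^-1 ^+ k) -> a <= b.
Proof.
move=> H; apply/ler_addgt0Pr => e e0.
pose k := Num.truncn (`|c| / e); have := H k.+1.
suff : c * 2^-1 ^+ k.+1 <= e by lra.
rewrite (le_trans (ler_wpM2r _ (ler_norm c)))// ?exprn_ge0//.
rewrite exprVn ler_pdivrMr ?exprn_gt0// mulrC -ler_pdivrMr//.
apply: (@le_trans _ _ k.+1%:R); first by rewrite ltW// truncnS_gt.
by rewrite -natrX ler_nat ltnW// ltn_expl.
Qed.

(** The intervals of centre [y k] and radius 2 c 2^-k, the tail of the geometric series, are nested.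
    The supremum of their lower ends lies in all of them, so the limit comes with its rate. *)
Lemma geometric_limit (y : nat -> R) (c : R) : 0 <= c ->
  (forall k, `|y k.+1 - y k| <= c * 2^-1 ^+ k) ->
  exists l, forall k, `|l - y k| <= 2 * c * 2^-1 ^+ k.
Proof.
move=> c0 H; pose a k := y k - 2 * c * 2^-1 ^+ k.
pose b k := y k + 2 * c * 2^-1 ^+ k.
have e0 k : 0 <= c * 2^-1 ^+ k by rewrite mulr_ge0// exprn_ge0.
have aS k : a k <= a k.+1.
  by have := H k; rewrite ler_norml /a exprS => /andP[]; have := e0 k; lra.
have bS k : b k.+1 <= b k.
  by have := H k; rewrite ler_norml /b exprS => /andP[]; have := e0 k; lra.
have aM j k : (j <= k)%N -> a j <= a k.
  by move: j k; exact/nondecreasing_seqP.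
have bM j k : (j <= k)%N -> b k <= b j.
  by move: j k; exact/nonincreasing_seqP.
have ab j k : a j <= b k.
  apply: (@le_trans _ _ (a (maxn j k))); first by rewrite aM// leq_maxl.
  apply: (@le_trans _ _ (b (maxn j k))); last by rewrite bM// leq_maxr.
  by rewrite /a /b; have := e0 (maxn j k); lra.
exists (sup (range a)) => k.
have al : a k <= sup (range a).
  by apply: ub_le_sup; [exists (b 0%N) => _ [j _ <-]|exists k].
have bl : sup (range a) <= b k.
  by apply: ge_sup; [exists (a 0%N); exists 0%N|move=> _ [j _ <-]].
by rewrite ler_norml; move: al bl; rewrite /a /b; lra.
Qed.

(** Bounds that are global in [x] allow a single contraction on the half-line, without gluing local
    solutions. Iterates are frozen at [x0] for negative times, which makes them [B]-Lipschitz on the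
    whole line, a property that passes to the limit. *)
Lemma picard n D (G : R -> 'cV[R]_n -> 'cV[R]_n) (L B : R) (x0 : 'cV[R]_n) :
  open D -> D `<=` [set t | 0 < t] -> cofin D -> 0 < L -> 0 < B ->
  (forall t x, D t -> `|G t x| <= B) ->
  (forall t x y, D t -> `|G t x - G t y| <= L * `|x - y|) ->
  (forall (y : R -> 'cV[R]_n) t, D t -> continuous y ->
     {for t, continuous (fun s => G s (y s))}) ->
  exists x : R -> 'cV[R]_n, [/\ x 0 = x0, continuous x
    & forall t, D t -> is_derive t 1 x (G t (x t))].
Proof.
move=> oD D0 cD L0 B0 GB GL Gc.
(* The specification is an implication so that choice ranges over all [y]; a discontinuous one
   receives an arbitrary image. *)
pose P (y z : R -> 'cV[R]_n) := continuous y ->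
  [/\ forall t, t <= 0 -> z t = x0, forall s t, `|z s - z t| <= B * `|s - t|
    & forall t, D t -> is_derive t 1 z (G t (y t))].
have /choice[F HF] : forall y, exists z, P y z.
  move=> y; have [cy|ncy] := pselect (continuous y); last by exists y.
  have [z [z0 zB zD]] := bounded_primitive_mx oD D0
    (fun t Dt => Gc y t Dt cy) (fun t Dt => GB t (y t) Dt) (ltW B0).
  exists (fun t => x0 + z t) => _; split=> [t t0|s t|t Dt].
  - by rewrite z0// addr0.
  - by rewrite opprD addrACA subrr add0r.
  - have := zD t Dt => zt; rewrite -[G t _]add0r.
    exact: (is_deriveD (is_derive_cst x0 t 1) zt).
pose lam := 2 * L; have lam0 : 0 < lam by rewrite mulr_gt0.
(* the weight [expR (2 * L * t)] turns the integral operator into a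
   contraction of ratio 1/2 on the whole half-line *)
have contr (y1 y2 : R -> 'cV[R]_n) (c : R) : 0 <= c -> continuous y1 -> continuous y2 ->
    (forall t, 0 <= t -> `|y1 t - y2 t| <= c * expR (lam * t)) ->
    forall t, 0 <= t -> `|F y1 t - F y2 t| <= c / 2 * expR (lam * t).
  move=> c0 cy1 cy2 H t t0.
  have [z10 z1B z1D] := HF y1 cy1; have [z20 z2B z2D] := HF y2 cy2.
  have e0 : 0 <= c / 2 * expR (lam * t) by rewrite mulr_ge0 ?divr_ge0 ?expR_ge0.
  apply/mx_norm_leP => // i j; rewrite (ord1 j) !mxE.
  apply: (@exponential_bound D (fun t => F y1 t i 0 - F y2 t i 0)) => //.
  - have c1 := @lip_entry_continuous _ _ _ i z1B; have c2 := @lip_entry_continuous _ _ _ i z2B.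
    by move=> s; apply: (@continuousB _ _ _ (fun t => F y1 t i 0)); [exact: c1|exact: c2].
  - move=> s s0 Ds; exists (G s (y1 s) i 0 - G s (y2 s) i 0).
      have d1 := (is_derive_mx _ _ _).2 (z1D s Ds) i 0.
      have d2 := (is_derive_mx _ _ _).2 (z2D s Ds) i 0.
      exact: (is_deriveB d1 d2).
    have := norm_entry_le (G s (y1 s) - G s (y2 s)) i 0; rewrite !mxE => h.
    rewrite (le_trans h)// (le_trans (GL s _ _ Ds))//.
    rewrite (_ : lam * _ * _ = L * (c * expR (lam * s))); last by rewrite /lam; field.
    by rewrite ler_pM2l// H// ltW.
  - by rewrite z10// z20// subrr normr0 divr_ge0.
pose y k := iter k F (fun=> x0).
have cy k : continuous (y k).
  elim: k => [|k IH]; first exact: cst_continuous.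
  by have [_ zB _] := HF _ IH; exact: lipschitz_continuous zB.
have ylip k s t : `|y k s - y k t| <= B * `|s - t|.
  case: k => [|k]; first by rewrite subrr normr0 mulr_ge0// ltW.
  by have [_ zB _] := HF _ (cy k); exact: zB.
have y0 k t : t <= 0 -> y k t = x0.
  by case: k => [//|k] t0; have [z0 _ _] := HF _ (cy k); exact: z0.
have C0 : 0 <= B / lam by rewrite divr_ge0 ?ltW.
(* [B / lam] is calibrated on the first iterate, whose derivative is bounded by B = lam (B / lam);
   each later step gains 1/2 through [contr]. *)
have ydist k t : 0 <= t ->
    `|y k.+1 t - y k t| <= B / lam * 2^-1 ^+ k * expR (lam * t).
  elim: k t => [|k IH] t t0; last first.
    rewrite exprSr mulrA.
    apply: (contr (y k.+1) (y k) _ _ (cy k.+1) (cy k) IH t t0).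
    by rewrite mulr_ge0// exprn_ge0.
  rewrite expr0 mulr1.
  have [z10 z1B z1D] := HF _ (cy 0%N).
  have e0 : 0 <= B / lam * expR (lam * t) by rewrite mulr_ge0 ?expR_ge0.
  apply/mx_norm_leP => // i j; rewrite (ord1 j) !mxE.
  apply: (@exponential_bound D (fun t => F (y 0%N) t i 0 - x0 i 0)) => //.
  - have c1 := @lip_entry_continuous _ _ _ i z1B.
    move=> s; apply: (@continuousB _ _ _ (fun t => F (y 0%N) t i 0)); first exact: c1.
    exact: cst_continuous.
  - move=> s s0 Ds; exists (G s (y 0%N s) i 0).
      have d1 := (is_derive_mx _ _ _).2 (z1D s Ds) i 0.
      rewrite -[G s _ _ _]subr0.
      exact: (is_deriveB d1 (is_derive_cst (x0 i 0) s 1)).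
    rewrite (le_trans (norm_entry_le _ _ _))// (le_trans (GB s _ Ds))//.
    rewrite mulrCA divff ?gt_eqF// mulr1.
    have : 1 <= expR (lam * s).
      by rewrite -[leLHS]expR0 ler_expR; apply: mulr_ge0; exact: ltW.
    by nra.
  - by rewrite z10// subrr normr0.
have {}ydist k t :
    `|y k.+1 t - y k t| <= B / lam * expR (lam * `|t|) * 2^-1 ^+ k.
  have [t0|t0] := leP 0 t; first by rewrite ger0_norm// mulrAC ydist.
  rewrite !(y0 _ t (ltW t0)) subrr normr0.
  by apply: mulr_ge0; [rewrite mulr_ge0 ?expR_ge0|rewrite exprn_ge0].
pose E (t : R) := B / lam * expR (lam * `|t|).
have E0 (t : R) : 0 <= E t by rewrite mulr_ge0// expR_ge0.
have /choice[l Hl] : forall ti : R * 'I_n, exists l, forall k,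
    `|l - y k ti.1 ti.2 0| <= 2 * E ti.1 * 2^-1 ^+ k.
  move=> [t i]; apply: geometric_limit => // k.
  have := norm_entry_le (y k.+1 t - y k t) i 0; rewrite !mxE => h.
  exact: le_trans h (ydist k t).
pose x t := \col_i l (t, i).
have xy k t : `|x t - y k t| <= 2 * E t * 2^-1 ^+ k.
  apply/mx_norm_leP => [|i j]; first by rewrite mulr_ge0 ?exprn_ge0// mulr_ge0.
  by rewrite (ord1 j) !mxE; exact: Hl (t, i) k.
have xlip s t : `|x s - x t| <= B * `|s - t|.
  apply: (@ler_geometric _ _ (2 * E s + 2 * E t)) => k.
  rewrite (_ : x s - x t = (x s - y k s) + (y k s - y k t) - (x t - y k t)); last first.
    by rewrite opprB; apply/matrixP => i j; rewrite !mxE; ring.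
  apply: (le_trans (ler_normB _ _)).
  have := ler_normD (x s - y k s) (y k s - y k t).
  by have := xy k s; have := xy k t; have := ylip k s t; lra.
have cx := lipschitz_continuous xlip.
(* Both sides are within a multiple of 2^-k of [y k.+1], the left one because [F] contracts the
   distance from [x] to [y k]. *)
have Fx : F x = x.
  apply/funext => t; apply/eqP; rewrite -subr_eq0 -normr_le0.
  apply: (@ler_geometric _ _ (2 * E t)) => k; rewrite add0r.
  have [t0|t0] := leP 0 t; last first.
    have [Fx0 _ _] := HF _ cx.
    by rewrite (Fx0 _ (ltW t0)) -(y0 k t (ltW t0)) distrC xy.
  rewrite (_ : F x t - x t = (F x t - y k.+1 t) - (x t - y k.+1 t)); last first.
    by rewrite opprB addrA subrK.
  rewrite (le_trans (ler_normB _ _))//.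
  have := xy k.+1 t; rewrite exprS.
  have c0 : 0 <= 2 * (B / lam) * 2^-1 ^+ k.
    by rewrite mulr_ge0 ?exprn_ge0// mulr_ge0.
  have cbound s : 0 <= s ->
      `|x s - y k s| <= 2 * (B / lam) * 2^-1 ^+ k * expR (lam * s).
    move=> s0; have := xy k s; rewrite /E ger0_norm//.
    by rewrite mulrA [X in _ <= X -> _]mulrAC.
  have := contr x (y k) _ c0 cx (cy k) cbound t t0.
  rewrite [X in _ <= X -> _](_ : _ = E t * 2^-1 ^+ k).
    by rewrite /= ; lra.
  by rewrite /E ger0_norm//; field; rewrite gt_eqF.
exists x; split=> // [|t Dt].
  by rewrite -Fx; have [Fx0 _ _] := HF _ cx; exact: Fx0.
by rewrite -{1}Fx; have [_ _ FD] := HF _ cx; exact: FD.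
Qed.

End Primitives.

(** * Euclidean norm *)

Section EuclideanNorm.
Context {R : realType}.

Lemma enorm_ge0 n (x : 'cV[R]_n) : 0 <= enorm x.
Proof. exact: sqrtr_ge0. Qed.

Lemma sqr_enorm n (x : 'cV[R]_n) : enorm x ^+ 2 = \sum_(i < n) x i 0 ^+ 2.
Proof. by rewrite sqr_sqrtr// sumr_ge0// => i _; exact: sqr_ge0. Qed.

Lemma enorm0 n : enorm (0 : 'cV[R]_n) = 0.
Proof.
apply/eqP; rewrite -sqrf_eq0 sqr_enorm big1// => i _.
by rewrite mxE expr0n.
Qed.

Lemma entry_le_enorm n (x : 'cV[R]_n) i : `|x i 0| <= enorm x.
Proof.
rewrite -(@ler_pXn2r _ 2) ?nnegrE ?enorm_ge0// sqr_enorm real_normK ?num_real//.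
by rewrite (bigD1 i)//= lerDl sumr_ge0// => j _; exact: sqr_ge0.
Qed.

Lemma norm_le_enorm n (x : 'cV[R]_n) : `|x| <= enorm x.
Proof.
apply/mx_norm_leP => [|i j]; first exact: enorm_ge0.
by rewrite (ord1 j) entry_le_enorm.
Qed.

Lemma enorm_le n (x : 'cV[R]_n) : enorm x <= n.+1%:R * `|x|.
Proof.
rewrite -(@ler_pXn2r _ 2) ?nnegrE ?enorm_ge0 ?mulr_ge0// sqr_enorm.
apply: (@le_trans _ _ (\sum_(i < n) `|x| ^+ 2)).
  apply: ler_sum => i _; rewrite -real_normK ?num_real//.
  by rewrite ler_pXn2r ?nnegrE// norm_entry_le.
rewrite sumr_const card_ord -[leLHS]mulr_natl exprMn ler_wpM2r ?sqr_ge0//.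
by rewrite -natrX ler_nat (leq_trans (leqnSn n))// leq_pmulr.
Qed.

Lemma enorm_eq0 n (x : 'cV[R]_n) : enorm x <= 0 -> x = 0.
Proof. by move=> x0; apply/eqP; rewrite -normr_le0 (le_trans (norm_le_enorm _)). Qed.

Lemma quad_le n (A : 'M[R]_n) (x : 'cV[R]_n) :
  (x^T *m A *m x) 0 0 <= (\sum_i \sum_j `|A i j|) * enorm x ^+ 2.
Proof.
rewrite mxE; under eq_bigr do rewrite mxE big_distrl/=.
rewrite exchange_big/= mulr_suml; apply: ler_sum => i _.
rewrite mulr_suml; apply: ler_sum => j _.
rewrite mxE (le_trans (ler_norm _))// !normrM mulrAC mulrC ler_wpM2l//.
by rewrite expr2 ler_pM// entry_le_enorm.
Qed.

Lemma dom_lipb n (f : 'cV[R]_n -> R) : lipb f -> f 0 = 0 -> dom f (@enorm R n).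
Proof.
move=> lf f0; split=> [e e0|M].
  have [L L0 HL] := lf 1; exists (Num.min 1 (e / (L + 1))) => [|x].
    by rewrite lt_min ltr01 divr_gt0// ltr_wpDl.
  rewrite le_min => /andP[x1 xe].
  have := HL x 0; rewrite (le_trans (norm_le_enorm _))// normr0 ler01 f0 !subr0.
  move=> /(_ isT isT) H; rewrite (le_trans (ler_norm _))// (le_trans H)//.
  apply: (@le_trans _ _ (L * (e / (L + 1)))).
    by rewrite ler_wpM2l// (le_trans (norm_le_enorm _)).
  rewrite mulrCA ler_piMr ?ltW//.
  by rewrite ltr_pdivrMr ?ltr_wpDl// mul1r ltrDl.
have [B _ HB] := lipb_bounded M lf; exists B => x xM.
by rewrite (le_trans (ler_norm _))// HB// (le_trans (norm_le_enorm _)).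
Qed.

Lemma norm_trmx_le p q (A : 'M[R]_(p, q)) : `|A^T| <= `|A|.
Proof. by apply/mx_norm_leP => // i j; rewrite mxE norm_entry_le. Qed.

(** Radial unboundedness gives the second half of [dom]. For the first, [f] is at least 1 beyond
    radius [r], and on the compact shell between radii [e] and [|r|] it has a positive minimum; a
    value below both forces [enorm x <= e]. *)
Lemma dom_proper n (f : 'cV[R]_n -> R) : lipb f -> posdef_fun f ->
  radially_unbounded f -> dom (@enorm R n) f.
Proof.
move=> lf [f0 fpos] fub; split=> [e e0|M]; last first.
  have [r Hr] := fub (M + 1); exists r => x xM; rewrite leNgt; apply/negP => rx.
  by have := Hr x (ltW rx); lra.
have [r Hr] := fub 1.
(* The shell is cut out by the squared norm, a polynomial, among row vectors, the setting of
   [EVT_min_rV]. *)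
pose s (y : 'rV[R]_n) := \sum_(i < n) y 0 i ^+ 2.
have sE y : s y = enorm y^T ^+ 2.
  by rewrite sqr_enorm; apply: eq_bigr => i _; rewrite mxE.
have ltr (g : 'cV[R]_n -> R) : lipb g -> continuous (fun y : 'rV[R]_n => g y^T).
  move=> lg; apply: lipb_continuous; apply: lipb_comp lg => [x|x y].
    exact: norm_trmx_le.
  by rewrite -linearB/= norm_trmx_le.
pose A := [set y : 'rV[R]_n | s y \in `[e ^+ 2, `|r| ^+ 2]].
have cs : continuous s.
  rewrite (_ : s = (fun y : 'rV[R]_n => \sum_(i < n) (y^T i 0) ^+ 2)).
    apply: (ltr (fun x => \sum_(i < n) x i 0 ^+ 2)).
    by apply: lipb_sum => i; apply: lipbX; exact: lipb_entry.
  by apply/funext => y; apply: eq_bigr => i _; rewrite mxE.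
have AE y : A y <-> e <= enorm y^T <= `|r|.
  rewrite /A/= in_itv/= sE.
  by rewrite !ler_pXn2r ?nnegrE ?enorm_ge0// ltW.
have cA : compact A.
  apply: bounded_closed_compact.
    exists `|r|; split; first exact: num_real.
    move=> M rM y /AE /andP[_ yr] /=.
    rewrite -[y]trmxK (le_trans (norm_trmx_le _))//.
    by rewrite (le_trans (norm_le_enorm _))// (le_trans yr)// ltW.
  have : closed (s @^-1` [set` `[e ^+ 2, `|r| ^+ 2]]).
    by apply: closed_comp => [y _|]; [exact: cs|exact: interval_closed].
  by [].
have small (x : 'cV[R]_n) : e <= enorm x -> f x < 1 -> A x^T.
  move=> ex fx; apply/AE; rewrite trmxK ex/=.
  rewrite leNgt; apply/negP => rx.
  by have := Hr x (le_trans (ler_norm r) (ltW rx)); lra.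
(* If the shell is empty, only the bound 1 beyond radius [r] matters, and 1/2 serves. *)
have [[y0 Ay0]|nA] := pselect (exists y, A y); last first.
  exists 2^-1; first by rewrite invr_gt0.
  move=> x fx; rewrite leNgt; apply/negP => ex; apply: nA.
  by exists x^T; apply: small; [exact: ltW|lra].
have [||y1 /set_mem Ay1 Hy1] := @EVT_min_rV _ _ (fun y => f y^T) A _ cA.
- by exists y0.
- by apply: continuous_subspaceT; exact: ltr.
have fy1 : 0 < f y1^T.
  apply: fpos; apply: contraTneq e0 => y1E; rewrite -leNgt.
  by have /AE/andP[+ _] := Ay1; rewrite y1E enorm0.
exists (Num.min (f y1^T / 2) 2^-1) => [|x].
  by rewrite lt_min divr_gt0//= invr_gt0.
rewrite le_min => /andP[fx1 fx2]; rewrite leNgt; apply/negP => ex.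
have := Hy1 x^T; rewrite trmxK inE => /(_ _)/le_trans/(_ fx1) H.
have : f y1^T <= f y1^T / 2 by apply: H; apply: small; [exact: ltW|lra].
by lra.
Qed.

End EuclideanNorm.

(** * Lyapunov functions *)

Section LyapunovISS.
Context {R : realType}.

(** The points missing before [t + 1] are finitely many, hence form a closed set, and [t] keeps a
    neighbourhood in [D]. Openness is what the construction of primitives asks for. *)
Lemma cofin_open (D : set R) : D `<=` [set t | 0 < t] -> cofin D -> open D.
Proof.
move=> D0 cD; rewrite openE => t Dt.
have cS : closed [set s : R | [/\ 0 < s, s < t + 1 & ~ D s]].
  apply: (@accessible_finite_set_closed R).1; last exact: cD.
  exact/hausdorff_accessible/Rhausdorff.
have oU : open (`]0, t + 1[ `&` ~` [set s : R | [/\ 0 < s, s < t + 1 & ~ D s]]).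
  by apply: openI; [exact: interval_open|exact: closed_openC].
rewrite /interior; apply: (@filterS _ _ _ (`]0, t + 1[ `&` ~` [set s : R | [/\ 0 < s, s < t + 1 & ~ D s]])).
  move=> s [/=]; rewrite in_itv/= => /andP[s0 st] Ds.
  by apply: contrapT => nDs; exact: Ds.
apply: open_nbhs_nbhs; split=> //; split => /=; last by case.
by rewrite in_itv/= D0//= ltrDl.
Qed.

Lemma enorm_le_sup m (v : R -> 'cV[R]_m) :
  [bounded v s | s in [set s : R | 0 <= s]] ->
  forall s, 0 <= s -> enorm (v s) <= sup_enorm v.
Proof.
move=> [M [_ HM]] s s0; apply: ub_le_sup; last by exists s.
exists (m.+1%:R * (M + 1)) => _ [r r0 <-]; rewrite (le_trans (enorm_le _))//.
by rewrite ler_wpM2l//; apply: HM => //; rewrite ltrDl.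
Qed.

Definition cutoff n (K : R) (x : 'cV[R]_n) : R :=
  Num.min 1 (Num.max 0 (K + 1 - `|x|)).

(** Projection onto a cube, which is a ball of the maximum norm. It makes the field bounded and
    Lipschitz on the whole space; [cutoff K] vanishes wherever [clip (K + 1)] moves the point, so
    the product is always a nonnegative multiple of the true field. *)
Definition clip n (K : R) (x : 'cV[R]_n) : 'cV[R]_n :=
  \col_i Num.max (- K) (Num.min K (x i 0)).

Lemma cutoff_itv n K (x : 'cV[R]_n) : 0 <= cutoff K x <= 1.
Proof. by rewrite /cutoff le_min ler01 ge_min !le_max !lexx. Qed.

Lemma cutoff1 n K (x : 'cV[R]_n) : `|x| <= K -> cutoff K x = 1.
Proof.
by move=> xK; rewrite /cutoff min_l// le_max; apply/orP; right; lra.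
Qed.

Lemma cutoff0 n K (x : 'cV[R]_n) : K + 1 <= `|x| -> cutoff K x = 0.
Proof.
by move=> xK; rewrite /cutoff (max_l (_ : _ <= 0)) ?min_r// subr_le0.
Qed.

Lemma cutoff_lip n K (x y : 'cV[R]_n) : `|cutoff K x - cutoff K y| <= `|x - y|.
Proof.
have := ler_dist_dist x y; rewrite ler_norml => /andP[h1 h2].
rewrite /cutoff ler_norml /Num.min /Num.max.
by apply/andP; split; do 4 (case: ifPn => //); lra.
Qed.

Lemma clip_norm n K (x : 'cV[R]_n) : 0 <= K -> `|clip K x| <= K.
Proof.
move=> K0; apply/mx_norm_leP => // i j; rewrite !mxE ler_norml /Num.min /Num.max.
by do 2 (case: ifPn => //); lra.
Qed.

Lemma clip_lip n K (x y : 'cV[R]_n) : `|clip K x - clip K y| <= `|x - y|.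
Proof.
apply/mx_norm_leP => // i j; rewrite !mxE.
have := norm_entry_le (x - y) i 0; rewrite !mxE !ler_norml => /andP[h1 h2].
have := normr_ge0 (x - y); rewrite /Num.min /Num.max.
by move=> h0; apply/andP; split; do 4 (case: ifPn => //); lra.
Qed.

Lemma clip_id n K (x : 'cV[R]_n) : `|x| <= K -> clip K x = x.
Proof.
move=> xK; apply/colP => i; rewrite mxE.
have := le_trans (norm_entry_le x i 0) xK; rewrite ler_norml => /andP[h1 h2].
by rewrite min_r// max_r.
Qed.

Context (n m : nat) (F : 'cV[R]_n -> 'cV[R]_m -> 'cV[R]_n).
(** [dV x v] stands for the derivative of [V] at [x] along [v]. It is given through the chain rule
    along curves and homogeneity in [v]; the latter carries the dissipation estimate over to the
    truncated field. *)
Context (V : 'cV[R]_n -> R) (dV : 'cV[R]_n -> 'cV[R]_n -> R) (al sg : R -> R).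
Context (lF : lipbmx (fun z : 'cV[R]_n * 'cV[R]_m => F z.1 z.2)).
Context (kal : kinf al) (ksg : kinf sg).
Context (lV : lipb V) (V0 : V 0 = 0) (Vge0 : forall x, 0 <= V x).
Context (domVE : dom V (@enorm R n)).
Hypothesis domEV : dom (@enorm R n) V.
Context (VdV : forall (y : R -> 'cV[R]_n) (t : R) (dy : 'cV[R]_n),
  is_derive t 1 y dy -> is_derive t 1 (fun s => V (y s)) (dV (y t) dy)).
Hypothesis dVZ : forall x c v, dV x (c *: v) = c * dV x v.
Context (dVF : forall x w, dV x (F x w) <= - 2 * al (V x) + sg (enorm w)).

Definition continuity_times (v : R -> 'cV[R]_m) : set R :=
  [set t | 0 < t /\ {for t, continuous v}].

Lemma continuity_times_cofin v : piecewise_continuous v -> cofin (continuity_times v).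
Proof.
move=> [Hv _ _] T; apply: sub_finite_set (Hv T) => t [t0 tT nD] /=; split=> //.
by move=> ct; apply: nD.
Qed.

Lemma Vcont_solution (x : R -> 'cV[R]_n) :
  {within `[0, +oo[, continuous x} -> {within `[0, +oo[, continuous (fun t => V (x t))}.
Proof.
by move=> cx; apply: within_continuous_comp cx => y _; exact: lipb_continuous.
Qed.

Lemma global_solution x0 v : piecewise_continuous v ->
  [bounded v s | s in [set s : R | 0 <= s]] -> exists x, is_solution F v x0 x.
Proof.
move=> pv bv; have cD := continuity_times_cofin pv.
set D := continuity_times v in cD.
have D0 : D `<=` [set t | 0 < t] by move=> t [].
have oD := cofin_open D0 cD.
have vD := enorm_le_sup bv; set d := sup_enorm v in vD.
have d0 : 0 <= d by rewrite (le_trans (enorm_ge0 (v 0)))// vD.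
(* Above this level 2 al(V) exceeds sg(d), so the sublevel set at [c], which contains [x0], will be
   invariant; [K] bounds it. *)
have [c [Vc sc c0]] : exists c, [/\ V x0 <= c, sg d <= al c & 0 <= c].
  have [r Hr] := kinf_surj kal (sg d).
  exists (Num.max (V x0) r); rewrite le_max lexx; split=> //.
    by rewrite -Hr kinf_le// le_max lexx orbT.
  by rewrite le_max Vge0.
have [_ /(_ c) [K HK]] := domEV.
have K0 : 0 <= K by rewrite (le_trans (enorm_ge0 x0))// HK.
have {}HK (x : 'cV[R]_n) : V x <= c -> `|x| <= K.
  by move=> /HK; apply: le_trans; exact: norm_le_enorm.
have K10 : 0 <= K + 1 by rewrite addr_ge0.
pose r := Num.max (K + 1) d.
have [L L0 HL] := lipbmx_lip lF r; have [B B0 HB] := lipbmx_bounded r lF.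
pose G (t : R) (x : 'cV[R]_n) := cutoff K x *: F (clip (K + 1) x) (v t).
have zr (t : R) (x : 'cV[R]_n) : D t -> `|(clip (K + 1) x, v t)| <= r.
  move=> /D0/ltW t0; rewrite prod_normE ge_max /r !le_max clip_norm//=.
  by rewrite (le_trans (norm_le_enorm _) (vD _ t0)) orbT.
have FB (t : R) (x : 'cV[R]_n) : D t -> `|F (clip (K + 1) x) (v t)| <= B.
  by move=> Dt; exact: (HB _ (zr t x Dt)).
have FL (t : R) (x y : 'cV[R]_n) : D t ->
    `|F (clip (K + 1) x) (v t) - F (clip (K + 1) y) (v t)| <= L * `|x - y|.
  move=> Dt; rewrite (le_trans (HL _ _ (zr t x Dt) (zr t y Dt)))//.
  apply: ler_wpM2l; first exact: ltW.
  rewrite prod_normE ge_max /= subrr normr0 normr_ge0 andbT.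
  exact: clip_lip.
have GB (t : R) (x : 'cV[R]_n) : D t -> `|G t x| <= B.
  move=> Dt; rewrite normrZ; have /andP[h0 h1] := cutoff_itv K x.
  by rewrite ger0_norm//; have := FB t x Dt; have := normr_ge0 (F (clip (K + 1) x) (v t)); nra.
have GL (t : R) (x y : 'cV[R]_n) : D t -> `|G t x - G t y| <= (L + B) * `|x - y|.
  move=> Dt.
  rewrite (_ : G t x - G t y =
    cutoff K x *: (F (clip (K + 1) x) (v t) - F (clip (K + 1) y) (v t)) +
    (cutoff K x - cutoff K y) *: F (clip (K + 1) y) (v t)); last first.
    by rewrite /G scalerBr scalerBl addrA subrK.
  rewrite (le_trans (ler_normD _ _))// !normrZ mulrDl lerD//.
    have /andP[h0 h1] := cutoff_itv K x.
    rewrite ger0_norm// (le_trans _ (FL t x y Dt))// ler_piMl//.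
  by rewrite mulrC ler_pM// ?FB// cutoff_lip.
have Gc (y : R -> 'cV[R]_n) t : D t -> continuous y ->
    {for t, continuous (fun s => G s (y s))}.
  move=> [t0 cv] cy; apply: continuousZ.
    apply: (@continuous_comp _ _ _ y (cutoff K)); first exact: cy.
    apply: lipb_continuous => ?; exists 1 => // a b _ _.
    by rewrite mul1r cutoff_lip.
  apply: (@continuous_comp _ _ _ (fun s => (clip (K + 1) (y s), v s))
                                 (fun z => F z.1 z.2)).
    apply: (@cvg_pair _ _ _ _ (nbhs (clip (K + 1) (y t))) (nbhs (v t))); last exact: cv.
    apply: (@continuous_comp _ _ _ y (clip (K + 1))); first exact: cy.
    apply: lipbmx_continuous => i j ?; exists 1 => // a b _ _; rewrite mul1r.
    apply: le_trans (clip_lip (K + 1) a b).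
    by have := norm_entry_le (clip (K + 1) a - clip (K + 1) b) i j; rewrite !mxE.
  exact: lipbmx_continuous.
have [x [x0E cx dx]] := picard x0 oD D0 cD (addr_gt0 L0 B0) B0 GB GL Gc.
have Vx t : 0 <= t -> V (x t) <= c.
  move=> t0; have cVx := Vcont_solution (continuous_subspaceT cx).
  apply: (barrier cD (lexx 0) cVx _ _ _ t0); last by rewrite x0E.
    move=> s s0 Ds cVs; exists (dV (x s) (G s (x s))); first exact/VdV/dx.
    (* Either the truncated field is zero, or it is [cutoff] times the true one, along which [V]
       does not grow above level [c]. *)
    rewrite dVZ; have [xK|Kx] := leP `|x s| (K + 1); last first.
      by rewrite cutoff0 ?mul0r// ltW.
    rewrite clip_id// mulr_ge0_le0//; first by have /andP[] := cutoff_itv K (x s).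
    have := dVF (x s) (v s).
    have : sg (enorm (v s)) <= sg d by rewrite kinf_le// vD// ltW.
    have : al c < al (V (x s)) by rewrite kinf_lt.
    have : 0 <= al c by exact: kinf_ge0.
    by lra.
  by move=> s s0 Ds; have := VdV (dx s Ds) => ?; exact: ex_derive.
exists x; split=> //; first exact: continuous_subspaceT.
move=> t t0 cv; have := dx t (conj t0 cv).
have xK := HK _ (Vx t (ltW t0)).
by rewrite /G cutoff1// scale1r clip_id// (le_trans xK)// lerDl.
Qed.

(** With V <= om(|x|) and |x| <= k1(V), beta is the decay function between [om] and [k1], and gamma
    is [k1] of the level al^-1(sg(d)) at which dissipation dominates the input. *)
Lemma lyapunov_ISS : F 0 0 = 0 -> ISS F.
Proof.
move=> F00; split=> //; first exact: (lipbmx_locally_lipschitz lF).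
have [a1 ka1 Ha1] := dom_kinf Vge0 (@enorm_ge0 R n) V0 (enorm0 n) domVE.
have [a2 ka2 Ha2] := dom_kinf (@enorm_ge0 R n) Vge0 (enorm0 n) V0 domEV.
have [om kom a1om] := kinf_inverse ka1.
have [k1 kk1 a2k1] := kinf_inverse ka2.
have [ral kral alral] := kinf_inverse kal.
have Vom x : V x <= om (enorm x) by rewrite -(kinf_le ka1) a1om.
have Ek1 x : enorm x <= k1 (V x) by rewrite -(kinf_le ka2) a2k1.
have [phi [phiE phiKL]] := decay_function kal.
exists (fun r t => k1 (phi (om `|r|) `|t|)), (k1 \o (ral \o sg)); split.
- exact: (phiKL om k1 kom kk1).
- by apply: kinf_class_K; apply: kinf_comp => //; exact: kinf_comp.
move=> x0 v pv bv; split; first exact: global_solution.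
move=> x [x0E cx dx] t t0; have cD := continuity_times_cofin pv.
have vD := enorm_le_sup bv; set d := sup_enorm v in vD *.
have d0 : 0 <= d by rewrite (le_trans (enorm_ge0 (v 0)))// vD.
rewrite (ger0_norm t0) (ger0_norm (enorm_ge0 _)) /=.
set p := phi _ _; set q := ral _.
have om0 : 0 <= om (enorm x0) by rewrite kinf_ge0 ?enorm_ge0.
have pE : p + t * al p = om (enorm x0) by exact: phiE.
have p0 : 0 <= p.
  rewrite leNgt; apply/negP => p0; have := pE.
  have : al p <= 0 by have [_ _ <- _ _] := kal; rewrite kinf_le// ltW.
  by nra.
have q0 : 0 <= q by rewrite !kinf_ge0.
(* In [decay_estimate], [p] secures the condition on the initial value and [q] the condition sg(d)
   <= al(c). *)
have Vt : V (x t) <= Num.max p q.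
  apply: (@decay_estimate _ _ (fun t => V (x t)) _ (sg d) _ _ cD kal) => //.
  - exact: Vcont_solution.
  - move=> s s0 [_ cvs]; exists (dV (x s) (F (x s) (v s))); first exact/VdV/dx.
    by rewrite (le_trans (dVF _ _))// lerD2l kinf_le// vD// ltW.
  - by rewrite le_max p0.
  - by rewrite -[leLHS]alral kinf_le// le_max lexx orbT.
  - rewrite x0E (le_trans (Vom _))// -pE lerD ?le_max ?lexx//.
    by rewrite ler_wpM2l// kinf_le// le_max lexx.
rewrite (le_trans (Ek1 _))//; apply: (@le_trans _ _ (k1 (Num.max p q))).
  by rewrite kinf_le.
by case: (leP p q) => _; rewrite ?lerDl ?lerDr kinf_ge0.
Qed.

End LyapunovISS.

(** * Derivatives and quadratic forms *)

Section ChainRule.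
Context {R : realType}.

Lemma is_derive_mulmx p q r (M : R -> 'M[R]_(p, q)) (N : R -> 'M[R]_(q, r))
    (dM : 'M[R]_(p, q)) (dN : 'M[R]_(q, r)) (t : R) :
  is_derive t 1 M dM -> is_derive t 1 N dN ->
  is_derive t 1 (fun s => M s *m N s) (dM *m N t + M t *m dN).
Proof.
move=> /is_derive_mx hM /is_derive_mx hN; apply/is_derive_mx => i j.
rewrite (_ : (fun s => (M s *m N s) i j) =
    \sum_(k < q) (fun s => M s i k * N s k j)); last first.
  by apply/funext => s; rewrite mxE fct_sumE.
rewrite (_ : (dM *m N t + M t *m dN) i j =
    \sum_(k < q) (M t i k *: dN k j + N t k j *: dM i k)); last first.
  rewrite !mxE -big_split/=; apply: eq_bigr => k _.
  by rewrite addrC [N t k j *: _]mulrC.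
apply: is_derive_sum => k.
exact: (is_deriveM (hM i k) (hN k j)).
Qed.

Lemma is_derive_trmx p q (M : R -> 'M[R]_(p, q)) (dM : 'M[R]_(p, q)) (t : R) :
  is_derive t 1 M dM -> is_derive t 1 (fun s => (M s)^T) dM^T.
Proof.
move=> /is_derive_mx hM; apply/is_derive_mx => i j; rewrite mxE.
by under eq_fun do rewrite mxE; exact: hM.
Qed.

(** Entry [i] of the jacobian applied to [dy] is the differential of the [i]-th component at [dy],
    by expansion in the canonical basis. *)
Lemma is_derive_jacobian n p (f : 'cV[R]_n -> 'cV[R]_p) (y : R -> 'cV[R]_n)
    (t : R) (dy : 'cV[R]_n) :
  (forall i x, differentiable (fun x => f x i 0) x) ->
  is_derive t 1 y dy ->
  is_derive t 1 (fun s => f (y s)) (jacobian_mx f (y t) *m dy).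
Proof.
move=> df hy; apply/is_derive_mx => i j; rewrite (ord1 j) {j}.
have dfi := df i (y t); pose g (x : 'cV[R]_n) : R := f x i 0.
have dyt : differentiable y t by apply/derivable1_diffP; exact: ex_derive.
have dgy : differentiable (g \o y) t by exact: differentiable_comp.
apply: DeriveDef; first exact/derivable1_diffP.
have -> : (fun s => f (y s) i 0) = g \o y by [].
rewrite deriveE// diff_comp//= -[X in 'd g _ X]deriveE// derive_val mxE.
have -> : dy = \sum_j dy j 0 *: delta_mx j 0.
  apply/colP => k; rewrite summxE (bigD1 k)//= !mxE !eqxx mulr1 big1 ?addr0//.
  by move=> l lk; rewrite !mxE eq_sym (negbTE lk) mulr0.
rewrite linear_sum/=; apply: eq_bigr => j _.
rewrite linearZ/= mxE -deriveE// [LHS]mulrC summxE; congr (_ * _).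
rewrite (bigD1 j)//= !mxE !eqxx mulr1 big1 ?addr0//.
by move=> l lj; rewrite !mxE eq_sym (negbTE lj) mulr0.
Qed.

Lemma mx11_trE (A : 'M[R]_1) : A^T = A.
Proof. by apply/matrixP => i j; rewrite mxE (ord1 i) (ord1 j). Qed.

Lemma is_derive_quad p (z : R -> 'cV[R]_p) (dz : 'cV[R]_p) (Q : 'M[R]_p) (t : R) :
  Q^T = Q -> is_derive t 1 z dz ->
  is_derive t 1 (fun s => ((z s)^T *m Q *m z s) 0 0)
    (2 * ((z t)^T *m Q *m dz) 0 0).
Proof.
move=> Qs hz.
have h1 := is_derive_mulmx (is_derive_trmx hz) (is_derive_cst Q t 1).
have h2 := is_derive_mulmx h1 hz.
have := (is_derive_mx _ _ _).2 h2 0 0.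
rewrite mulmx0 addr0 mxE (_ : (dz^T *m Q *m z t) = (z t)^T *m Q *m dz).
  by rewrite -mulr2n -[in X in X -> _]mulr_natl.
by rewrite -[LHS]mx11_trE !trmx_mul trmxK Qs mulmxA.
Qed.

End ChainRule.

Section QuadraticForms.
Context {R : realType}.

Lemma posdefmx_unit p (P : 'M[R]_p) : posdefmx P -> P \in unitmx.
Proof.
move=> [Ps Ppos]; rewrite -row_free_unit -kermx_eq0; apply/negPn/negP.
move=> /rowV0Pn[u uk u0].
have uP : u *m P = 0 by apply/sub_kermxP.
have := Ppos u^T; rewrite trmxK uP mul0mx mxE ltxx => H.
by have := H (_ : u^T != 0); rewrite -(inj_eq (@trmx_inj _ _ _)) trmxK trmx0 u0 => /(_ isT).
Qed.

(* Expanding [(z - c P^-1 z)^T P (z - c P^-1 z) >= 0]. *)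
Lemma posdefmx_inv_ge p (P : 'M[R]_p) : posdefmx P ->
  exists2 c, 0 < c & forall z : 'cV[R]_p,
    enorm z ^+ 2 <= c * (z^T *m invmx P *m z) 0 0.
Proof.
move=> hP; have Pu := posdefmx_unit hP; have [Ps Ppos] := hP.
(* Dominates the quadratic form of [P]; the 1 keeps it positive, so that a factor c can be cancelled
   from c |z|^2 <= c^2 z^T P^-1 z. *)
pose c := 1 + \sum_i \sum_j `|P i j|.
have c0 : 0 < c by rewrite ltr_pwDl// !sumr_ge0// => i _; rewrite sumr_ge0.
exists c => // z; pose q := invmx P *m z.
have Pq : P *m q = z by rewrite mulKVmx.
have qP : q^T *m P = z^T by rewrite -{1}Ps -trmx_mul Pq.
have zz : (z^T *m z) 0 0 = enorm z ^+ 2.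
  by rewrite sqr_enorm mxE; apply: eq_bigr => i _; rewrite mxE.
have h0 : 0 <= ((z - c *: q)^T *m P *m (z - c *: q)) 0 0.
  have [->|/Ppos/ltW//] := eqVneq (z - c *: q) 0.
  by rewrite mulmx0 mxE.
have E : (z - c *: q)^T *m P *m (z - c *: q) =
    z^T *m P *m z - (2 * c) *: (z^T *m z) + c ^+ 2 *: (z^T *m invmx P *m z).
  have -> : (z - c *: q)^T = z^T - c *: q^T by rewrite linearB linearZ.
  rewrite mulmxBl -scalemxAl qP mulmxBr !mulmxBl -!scalemxAl -!scalemxAr.
  rewrite -(mulmxA z^T P q) Pq (mulmxA z^T (invmx P)).
  move: (z^T *m P *m z) (z^T *m z) (z^T *m invmx P *m z) => a b d.
  by apply/matrixP => i j; rewrite !mxE; ring.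
have hP2 := quad_le P z.
have hP3 : (z^T *m P *m z) 0 0 <= c * enorm z ^+ 2.
  by rewrite (le_trans hP2)// ler_wpM2r ?sqr_ge0// /c lerDr.
move: h0 hP3; rewrite E -zz.
move: (z^T *m P *m z) (z^T *m z) (z^T *m invmx P *m z) => a b d.
rewrite !mxE => h0 hP3; rewrite -(ler_pM2l c0).
by clearbody c; lra.
Qed.

End QuadraticForms.

Section MatrixInequality.
Context {R : realType}.

Lemma gram_quad_ge0 k p (Q : 'M[R]_(k, p)) (v : 'cV[R]_p) :
  0 <= (v^T *m (Q^T *m Q) *m v) 0 0.
Proof.
rewrite mulmxA -trmx_mul -mulmxA mxE; apply: sumr_ge0 => i _.
by rewrite mxE -expr2 sqr_ge0.
Qed.

(* The quadratic form of the matrix inequality at the vector [(q, w)]. *)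
Lemma block_quad_le p m (M11 : 'M[R]_p) (L : 'M[R]_(m, p)) (G : 'M[R]_m)
    k (Q : 'M[R]_(k, p + m)) (q : 'cV[R]_p) (w : 'cV[R]_m) :
  block_mx M11 L^T L (- G) = - (Q^T *m Q) ->
  (q^T *m M11 *m q) 0 0 + 2 * (q^T *m (L^T *m w)) 0 0 <= (w^T *m G *m w) 0 0.
Proof.
move=> E; pose v := col_mx q w.
have h := gram_quad_ge0 Q v.
move: h; rewrite -[Q^T *m Q]opprK -E mulmxN mulNmx /v tr_col_mx mul_row_block.
rewrite mul_row_col !mulmxDl mulmxN mulNmx.
have -> : w^T *m L *m q = q^T *m (L^T *m w).
  by rewrite -[LHS]mx11_trE !trmx_mul trmxK.
rewrite -(mulmxA q^T L^T w).
move: (q^T *m M11 *m q) (q^T *m (L^T *m w)) (w^T *m G *m w) => a b d.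
by rewrite !mxE; lra.
Qed.

End MatrixInequality.

(** * Dissipation inequality of the closed loop and its comparison functions *)

Theorem corollary4p7 (R : realType) (n m N M Nh : nat)
  (Z : 'cV[R]_n -> 'cV[R]_N) (W : 'cV[R]_n -> 'M[R]_(M, m))
  (A : 'M[R]_(n, N)) (B : 'M[R]_(n, M))
  (Zh : 'cV[R]_n -> 'cV[R]_Nh) (H : 'cV[R]_n -> 'M[R]_(N, Nh))
  (hZ : forall i, monomial_fun (fun x => Z x i 0))
  (hZ0 : Z 0 = 0)
  (hW : forall i j, monomial_fun (fun x => W x i j))
  (hZh : polymx Zh) (hH : polymx H)
  (hZh0 : forall x, Zh x = 0 <-> x = 0)
  (hZH : forall x, Z x = H x *m Zh x)
  (hZh_unbounded : radially_unbounded (fun x => enorm (Zh x)))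
  (Xi : 'cV[R]_n -> 'M[R]_Nh) (hXi : sym_polymx Xi)
  (eps : R) (heps : 0 < eps)
  (P : 'M[R]_Nh) (hP : posdefmx P)
  (Y : 'cV[R]_n -> 'M[R]_(m, Nh)) (hY : polymx Y)
  (Gamma : R -> 'M[R]_m) (hGamma : univ_polymx Gamma)
  (Theta : 'cV[R]_n -> 'M[R]_Nh) (hTheta : sym_polymx Theta)
  (eta : R) (heta : 0 < eta)
  (STheta : 'cV[R]_n -> 'M[R]_Nh) (hSTheta : sos_polymx STheta)
  (Sd : 'cV[R]_(n + m) -> 'M[R]_(Nh + m)) (hSd : sos_polymx Sd)
  (ha : exists (nu : nat) (C : 'I_nu.+1 -> 'M[R]_m),
     [/\ forall j, psdmx (C j),
         psdmx (\sum_(j < nu.+1) C j - eps%:M)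
       & forall r, Gamma r = \sum_(j < nu.+1) r ^+ (2 * j) *: C j])
  (hb : forall x, Theta x - eta *: Xi x = STheta x)
  (hc : forall (x : 'cV[R]_n) (w : 'cV[R]_m),
     let J := jacobian_mx Zh x in
     let L := (col_mx (0 : 'M[R]_(N, m)) (W x))^T *m (row_mx A B)^T *m J^T in
     block_mx
       (Tp (J *m row_mx A B *m col_mx (H x *m P) (W x *m Y x)) + Theta x) L^T
       L (- Gamma (enorm w))
     = - Sd (col_mx x w))
  (b_posdef : posdef_fun
     (fun x => ((Zh x)^T *m invmx P *m Xi x *m invmx P *m Zh x) 0 0))
  (b_unbounded : radially_unbounded
     (fun x => ((Zh x)^T *m invmx P *m Xi x *m invmx P *m Zh x) 0 0)) :
  ISS (fun (x : 'cV[R]_n) (w : 'cV[R]_m) =>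
    row_mx A B *m col_mx (H x *m Zh x)
                         (W x *m (Y x *m invmx P *m Zh x + w))).
Proof.
have Pu := posdefmx_unit hP; have [Ps Ppos] := hP.
have Pis : (invmx P)^T = invmx P by rewrite trmx_inv Ps.
have lZh := polymx_lipb hZh.
have lW : lipbmx W by move=> i j; exact: monomial_lipb.
pose F := fun (x : 'cV[R]_n) (w : 'cV[R]_m) =>
    row_mx A B *m col_mx (H x *m Zh x)
                         (W x *m (Y x *m invmx P *m Zh x + w)).
pose V x : R := ((Zh x)^T *m invmx P *m Zh x) 0 0.
pose dV x (v : 'cV[R]_n) : R := 2 * ((Zh x)^T *m invmx P *m (jacobian_mx Zh x *m v)) 0 0.
pose b x : R := ((Zh x)^T *m invmx P *m Xi x *m invmx P *m Zh x) 0 0.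
pose g (w : 'cV[R]_m) : R := (w^T *m Gamma (enorm w) *m w) 0 0.
have [nu [C [Cpsd _ GammaE]]] := ha.
have lF : lipbmx (fun z : 'cV[R]_n * 'cV[R]_m => F z.1 z.2).
  apply: lipbmxM; first exact: lipbmx_cst.
  apply: lipbmx_col.
    apply: (@lipbmx_fst _ _ _ _ _ (fun x => H x *m Zh x)).
    by apply: lipbmxM => //; exact: polymx_lipb.
  apply: (@lipbmxM R _ _ _ _ (fun z : 'cV[R]_n * 'cV[R]_m => W z.1)).
    exact: (@lipbmx_fst _ _ _ _ _ W lW).
  apply: lipbmxD; last exact: (@lipbmx_snd _ _ _ _ _ _ (@lipbmx_id R m)).
  apply: (@lipbmx_fst _ _ _ _ _ (fun x => Y x *m invmx P *m Zh x)).
  apply: lipbmxM => //; apply: lipbmxM; last exact: lipbmx_cst.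
  exact: polymx_lipb.
have lZhP : lipbmx (fun x => (Zh x)^T *m invmx P).
  by apply: lipbmxM; [exact: lipbmx_tr|exact: lipbmx_cst].
have lV : lipb V by exact: (lipbmxM lZhP lZh 0 0).
have lb : lipb b.
  have lXi := polymx_lipb hXi.1.
  have h : lipbmx (fun x => (Zh x)^T *m invmx P *m Xi x *m invmx P).
    by apply: lipbmxM; [exact: lipbmxM|exact: lipbmx_cst].
  exact: (lipbmxM h lZh 0 0).
have lg : lipb g.
  have lG : lipbmx (fun w : 'cV[R]_m => Gamma (enorm w)).
    move=> i j.
    (* Even powers of [enorm w] are powers of the sum of squares of the entries, which removes the
       square root. *)
    have -> : (fun w : 'cV[R]_m => Gamma (enorm w) i j) =
        fun w => \sum_(k < nu.+1) (\sum_(l < m) w l 0 ^+ 2) ^+ k * C k i j.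
      apply/funext => w; rewrite GammaE summxE; apply: eq_bigr => k _.
      by rewrite mxE exprM sqr_enorm.
    apply: lipb_sum => k; apply: lipbM; last exact: lipb_cst.
    by apply: lipbX; apply: lipb_sum => l; apply: lipbX; exact: lipb_entry.
  have h : lipbmx (fun w : 'cV[R]_m => w^T *m Gamma (enorm w)).
    by apply: lipbmxM => //; apply: lipbmx_tr; exact: lipbmx_id.
  exact: (lipbmxM h (@lipbmx_id R m) 0 0).
have dVF0 x w : dV x (F x w) <= - eta * b x + g w.
  have [_ [k [Q [_ QE]]]] := hSd; have [_ [k' [Q' [_ QE']]]] := hSTheta.
  have := hc x w; rewrite QE => /block_quad_le.
  set J := jacobian_mx Zh x; set K := J *m row_mx A B *m _.
  pose q := invmx P *m Zh x => /(_ q w); rewrite -/(g w).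
  have Pq : P *m q = Zh x by rewrite mulKVmx.
  have qT : q^T = (Zh x)^T *m invmx P by rewrite trmx_mul Pis.
  (* Since [P *m q] is [Zh x], H Zh = H P q and Y P^-1 Zh = Y q: the undisturbed closed loop is the
     matrix of the upper left block applied to [q]. *)
  have JF : J *m F x w = K *m q + J *m row_mx A B *m col_mx 0 (W x) *m w.
    rewrite /F /K -!mulmxA -!mulmxDr; congr (_ *m (_ *m _)).
    rewrite !mul_col_mx add_col_mx mul0mx addr0 -!mulmxA Pq.
    by rewrite -mulmxDr.
  have -> : dV x (F x w) = 2 * ((q^T *m (K *m q)) 0 0 +
      (q^T *m (J *m row_mx A B *m col_mx 0 (W x) *m w)) 0 0).
    by rewrite /dV -qT -/J JF mulmxDr [in LHS]mxE.
  rewrite (_ : (_ *m J^T)^T = J *m row_mx A B *m col_mx 0 (W x)); last first.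
    by rewrite !trmx_mul !trmxK mulmxA.
  (* [Tp] doubles the scalar, and Theta splits into eta Xi, which produces eta b, and a sum of
     squares. *)
  have -> : (q^T *m (Tp K + Theta x) *m q) 0 0 =
      2 * (q^T *m (K *m q)) 0 0 + eta * b x + (q^T *m STheta x *m q) 0 0.
    have -> : Theta x = eta *: Xi x + STheta x by rewrite -hb addrC subrK.
    have -> : b x = (q^T *m Xi x *m q) 0 0 by rewrite /b qT /q !mulmxA.
    have KT : q^T *m K^T *m q = q^T *m (K *m q).
      by rewrite -[LHS]mx11_trE !trmx_mul !trmxK.
    rewrite /Tp !(mulmxDr, mulmxDl) KT -mulmxA -!scalemxAr -!scalemxAl.
    move: (q^T *m (K *m q)) (q^T *m Xi x *m q) (q^T *m STheta x *m q) => a1 a2 a3.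
    by rewrite !mxE; ring.
  have : 0 <= (q^T *m STheta x *m q) 0 0 by rewrite QE' gram_quad_ge0.
  by lra.
have Zh0 : Zh 0 = 0 by apply/hZh0.
have [cV cV0 HcV] := posdefmx_inv_ge hP.
have Vpos x : x != 0 -> 0 < V x.
  move=> x0; have z0 : 0 < enorm (Zh x).
    rewrite lt_neqAle enorm_ge0 andbT eq_sym; apply: contra x0 => /eqP z0.
    by apply/eqP/hZh0/enorm_eq0; rewrite z0.
  have := HcV (Zh x); rewrite -/(V x) => h.
  by rewrite -(pmulr_rgt0 _ cV0) (lt_le_trans _ h)// exprn_gt0.
have V0 : V 0 = 0 by rewrite /V Zh0 mulmx0 mxE.
have Vge0 x : 0 <= V x.
  by have [->|/Vpos/ltW//] := eqVneq x 0; rewrite V0.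
have V_unb : radially_unbounded V.
  (* The added 1 ensures |Zh| >= 1, hence |Zh|^2 >= |Zh| >= cV |K|. *)
  move=> K; have [r Hr] := hZh_unbounded (cV * `|K| + 1); exists r => x /Hr h.
  have := HcV (Zh x); rewrite -/(V x) => h2.
  have h1 : 0 <= cV * `|K| by rewrite mulr_ge0// ltW.
  have h3 : K <= `|K| by exact: ler_norm.
  rewrite -(ler_pM2l cV0) (le_trans _ h2)//.
  by move: (enorm (Zh x)) h => e h; nra.
have g0 : g 0 = 0 by rewrite /g mulmx0 mxE.
have gge0 w : 0 <= g w.
  rewrite /g GammaE mulmx_sumr mulmx_suml summxE; apply: sumr_ge0 => j _.
  rewrite -scalemxAr -scalemxAl mxE mulr_ge0//; last exact: (Cpsd j).2.
  by rewrite exprn_ge0// enorm_ge0.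
have [b0 bpos] := b_posdef.
(* Halved because al(V) <= eta b / 2 is what yields -eta b <= -2 al(V). *)
pose b2 x := eta / 2 * b x.
have b2E : dom (@enorm R n) b2.
  have e20 : 0 < eta / 2 by rewrite divr_gt0.
  apply: dom_proper; first by apply: lipbM lb; exact: lipb_cst.
    by split=> [|x x0]; [rewrite /b2 /b b0 mulr0|rewrite mulr_gt0// bpos].
  move=> K; have [r Hr] := b_unbounded (K / (eta / 2)); exists r => x /Hr.
  by rewrite ler_pdivrMr// mulrC.
have b2ge0 x : 0 <= b2 x.
  apply: mulr_ge0; first by rewrite divr_ge0// ltW.
  by have [->|/bpos/ltW//] := eqVneq x 0; rewrite /b b0.
have b20 : b2 0 = 0 by rewrite /b2 /b b0 mulr0.
have domVE := dom_lipb lV V0.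
have domEV := dom_proper lV (conj V0 Vpos) V_unb.
(* [V] is dominated by |x|, and |x| by [b2], whence al(V) <= b2; below, inverting ag(g) <= |w| gives
   g <= sg(|w|). *)
have [al kal Hal] := dom_kinf Vge0 b2ge0 V0 b20 (dom_trans domVE b2E).
have [ag kag Hag] := dom_kinf gge0 (@enorm_ge0 R m) g0 (enorm0 m) (dom_lipb lg g0).
have [sg ksg agsg] := kinf_inverse kag.
apply: (@lyapunov_ISS _ _ _ F V dV al sg) => //.
- move=> y t dy hy.
  have hz := is_derive_jacobian (fun i x => polynomial_differentiable x (hZh i 0)) hy.
  exact: (is_derive_quad Pis hz).
- move=> x c v; rewrite /dV -!scalemxAr mxE; ring.
- move=> x w; rewrite (le_trans (dVF0 x w))// lerD//.
    have := Hal x; rewrite /b2; lra.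
  by rewrite -(kinf_le kag) agsg.
- by rewrite /F Zh0 !mulmx0 addr0 mulmx0 col_mx0 mulmx0.
Qed.
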